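(* Let $\gamma\in(0,1)$ be a fixed constant and let $m=m(n)\in\mathbb{N}$ satisfy $m\sim\gamma\binom{n}{2}$ as $n\to\infty$. Then $$\lim_{n\to\infty}\frac{1}{\binom{n}{2}}\log_2|\mathcal{C}(n,m)|=r^\ast(\gamma)\,,$$ where $$r^\ast(\gamma)=\begin{cases}\frac{5+\sqrt{5}}{10}H\big(\frac{3-\sqrt{5}}{2}\big)\gamma&\gamma\in\big[0,\frac{5-\sqrt{5}}{4}\big)\\[4pt]\frac{1}{2}H(2\gamma-1)&\gamma\in\big[\frac{5-\sqrt{5}}{4},1\big]\end{cases}\,.$$
   Context: A graph is claw-free if it has no induced subgraph isomorphic to $K_{1,3}$. $\mathcal{C}(n,m)$ denotes the set of labeled claw-free graphs on the vertex set $\{1,\dots,n\}$ with exactly $m$ edges. $H(x)=-x\log_2x-(1-x)\log_2(1-x)$ is the binary entropy, with $0\log_20=0$. $f(n)\sim g(n)$ means $f(n)/g(n)\to1$. *)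

(* Defs.v *)
From HB Require Import structures.
From mathcomp Require Import all_boot all_order all_algebra.
From mathcomp Require Import all_classical all_reals all_analysis.

Set Implicit Arguments.
Unset Strict Implicit.
Unset Printing Implicit Defensive.

Import Order.TTheory GRing.Theory Num.Theory.
Import numFieldNormedType.Exports.

Local Open Scope classical_set_scope.
Local Open Scope ring_scope.

(* A labeled simple graph on the finite vertex set T is represented by its set
   of edges, an edge being a two-element subset of T. *)
Definition simple_graph (T : finType) (E : {set {set T}}) : bool :=
  [forall e in E, #|e| == 2%N].

Definition induced (T : finType) (E : {set {set T}}) (S : {set T}) :
  {set {set T}} := [set e in E | e \subset S]%SET.

(* f is an isomorphism from the graph (U, F) onto the subgraph of (T, E)
   induced by the image of f. *)
Definition has_induced_copy (U T : finType) (F : {set {set U}})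
    (E : {set {set T}}) : bool :=
  [exists f : {ffun U -> T},
    injectiveb f &&
    (induced E (f @: [set: U]%SET)%SET
       == [set (f @: (e : {set U}))%SET | e in F]%SET)].

(* K_{1,3}, with centre 0 and leaves 1, 2, 3. *)
Definition claw : {set {set 'I_4}} :=
  [set [set (ord0 : 'I_4); i]%SET | i in [set~ (ord0 : 'I_4)]%SET]%SET.

Definition claw_free (T : finType) (E : {set {set T}}) : bool :=
  ~~ has_induced_copy claw E.

Definition claw_free_graphs (n m : nat) : {set {set {set 'I_n}}} :=
  [set E : {set {set 'I_n}} |
    [&& simple_graph E, claw_free E & #|E| == m]]%SET.

(* ln x = 0 for x <= 0, hence log2 0 = 0. *)
Definition log2 {R : realType} (x : R) : R := ln x / ln 2.

Definition binary_entropy {R : realType} (x : R) : R :=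
  - x * log2 x - (1 - x) * log2 (1 - x).

Definition asymp_equiv {R : realType} (f g : nat -> R) : Prop :=
  (fun n => f n / g n) @ \oo --> (1 : R).

(* Only meaningful for gamma in [0, 1]. *)
Definition rstar {R : realType} (gamma : R) : R :=
  if gamma < (5 - Num.sqrt 5) / 4
  then (5 + Num.sqrt 5) / 10 * binary_entropy ((3 - Num.sqrt 5) / 2) * gamma
  else 1 / 2 * binary_entropy (2 * gamma - 1).

(* Main.v *)
(* Let [w] be uniform in C(n,m) and reveal all pairs meeting a set [S] of [k]
   vertices, within a larger window.  The conditional entropy [a_k] of one further
   pair only depends on [k] and decreases, so for some bounded [k] it hardly drops
   when a window [U] of [K] more vertices is added to [S].  For this [k] the pairs
   of [U] are nearly independent given the pairs of [S :|: U] that meet [S], and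
   [ln |C(n,m)|] is at most about [a_k * 'C(n,2)].  A claw has probability zero, so
   almost surely the conditional edge probabilities in [U] form a template
   (white: near 0, black: near 1, grey: otherwise) in which no claw can be
   realised.  Such a template has at most [2 K] more grey than black pairs.

   Weighting edges by [la], a grey pair contributes at most [g = ln (1 + la)] and a
   black one [b = ln la]; since
   [g G + b B = (g - b)/2 (G - B) + (g + b)/2 (G + B)], this gives, when
   [0 <= g + b], [ln |C(n,m)| <= ((g + b)/2 - gamma b + o(1)) 'C(n,2)].  The choice
   [la = p / (1 - p)] with [p] the larger of [(3 - sqrt 5)/2] and [2 gamma - 1]
   yields [rstar gamma].  Conversely, two disjoint cliques of equal size with
   density [p] between them, and isolated vertices, are claw-free; counting the
   bipartite graphs between the cliques gives the lower bound. *)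
Require Import Defs.
From HB Require Import structures.
From mathcomp Require Import all_boot all_order all_algebra.
From mathcomp Require Import all_classical all_reals all_analysis.
From mathcomp Require Import fingroup perm zify ring lra.

Set Implicit Arguments.
Unset Strict Implicit.
Unset Printing Implicit Defensive.

Import Order.TTheory GRing.Theory Num.Theory.
Import numFieldNormedType.Exports.

(** * Binary entropy *)

Section BinaryEntropy.
Local Open Scope ring_scope.
Variable R : realType.
Implicit Types p q : R.

Definition nat_entropy (x : R) : R := - x * ln x - (1 - x) * ln (1 - x).

Lemma ln_le_subr1 p : 0 < p -> ln p <= p - 1.
Proof.
move=> p0; rewrite -[X in ln X](subrKC 1).
by apply: le_ln1Dx; rewrite ltrBrDr addNr.
Qed.

(** This is $\ln x \le x - 1$ at $x = q/p$, multiplied by $p$. Since [ln 0 = 0] here, the case of an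
    infinite right-hand side is excluded by the implication from [q = 0]. *)
Lemma gibbs_term p q : 0 <= p -> 0 <= q -> (q = 0 -> p = 0) ->
  - p * ln p <= - p * ln q + (q - p).
Proof.
move=> p0 q0 pq; have [->|pn0] := eqVneq p 0; first by rewrite subr0 oppr0 !mul0r add0r.
have qn0 : q != 0 by apply: contra_neq pn0.
have {pn0}pp : 0 < p by rewrite lt_def pn0.
have {qn0}qp : 0 < q by rewrite lt_def qn0.
have := ln_le_subr1 (divr_gt0 qp pp); rewrite ln_div ?posrE //.
rewrite -(ler_pM2l pp) (_ : p * (q / p - 1) = q - p); last by field; rewrite gt_eqF.
by lra.
Qed.

Lemma gibbs p q : 0 <= p <= 1 -> 0 <= q <= 1 -> (q = 0 -> p = 0) ->
  (q = 1 -> p = 1) ->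
  nat_entropy p <= - p * ln q - (1 - p) * ln (1 - q).
Proof.
move=> /andP[p0 p1] /andP[q0 q1] h0 h1; rewrite /nat_entropy.
have g1 := gibbs_term p0 q0 h0.
have g2 : - (1 - p) * ln (1 - p) <= - (1 - p) * ln (1 - q) + ((1 - q) - (1 - p)).
  apply: gibbs_term; rewrite ?subr_ge0 // => /eqP; rewrite subr_eq0 => /eqP e.
  by rewrite h1 ?subrr.
lra.
Qed.

Lemma nat_entropy_gibbs p q : 0 <= p <= 1 -> 0 < q < 1 ->
  nat_entropy p <= - p * ln q - (1 - p) * ln (1 - q).
Proof.
move=> hp /andP[q0 q1]; apply: gibbs => //; first by rewrite !ltW.
  by move=> e; rewrite e ltxx in q0.
by move=> e; rewrite e ltxx in q1.
Qed.

Lemma nat_entropy_ge0 p : 0 <= p <= 1 -> 0 <= nat_entropy p.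
Proof.
move=> /andP[p0 p1]; rewrite /nat_entropy.
have l1 : ln p <= 0 by apply: ln_le0.
have l2 : ln (1 - p) <= 0 by apply: ln_le0; lra.
nra.
Qed.

Lemma nat_entropyN p : nat_entropy (1 - p) = nat_entropy p.
Proof. by rewrite /nat_entropy subKr; ring. Qed.

Lemma nat_entropy_le_ln2 p : 0 <= p <= 1 -> nat_entropy p <= ln 2.
Proof.
move=> hp; apply: le_trans (@nat_entropy_gibbs p (1/2) hp _) _; first lra.
have -> : 1 - 1 / 2 = (1/2 : R) by field.
rewrite div1r lnV ?posrE //; lra.
Qed.

(** Gibbs' inequality against the law with odds [la], whose log-partition function is
    [ln (1 + la)]. *)
Lemma nat_entropy_tilted p (la : R) : 0 <= p <= 1 -> 0 < la ->
  nat_entropy p + p * ln la <= ln (1 + la).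
Proof.
move=> hp la0; have l1 : 0 < 1 + la by lra.
have hq : 0 < la / (1 + la) < 1.
  by rewrite divr_gt0 //= ltr_pdivrMr // mul1r ltrDr.
have := nat_entropy_gibbs hp hq.
have -> : 1 - la / (1 + la) = (1 + la)^-1 by field; rewrite gt_eqF.
rewrite ln_div ?posrE // lnV ?posrE //; lra.
Qed.

(** Gibbs' inequality against $q = s^{-2}$: the first term is at most $2 s^{-2} \ln s \le 2/s$, the
    second at most $-\ln(1-q) \le 2q \le 1/s$. *)
Lemma nat_entropy_small p (s : nat) : (2 <= s)%N -> 0 <= p <= (s%:R ^+ 2)^-1 ->
  nat_entropy p <= 4 / s%:R.
Proof.
move=> s2 /andP[p0 ps].
have s2R : 2 <= (s%:R : R) by rewrite ler_nat.
have s0 : 0 < (s%:R : R) by lra.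
set t : R := s%:R in ps s2R s0 *.
have t2 : 0 < t ^+ 2 by rewrite exprn_gt0.
have e0 : 0 < (t ^+ 2)^-1 by rewrite invr_gt0.
have e4 : (t ^+ 2)^-1 <= 1 / 4.
  rewrite div1r lef_pV2 ?posrE //; nra.
have hq : 0 < (t ^+ 2)^-1 < 1 by lra.
have hp : 0 <= p <= 1 by lra.
apply: le_trans (nat_entropy_gibbs hp hq) _.
rewrite lnV ?posrE // lnXn //.
have lt1 : ln t <= t by apply/ltW/ln_sublinear.
have lt0 : 0 <= ln t by apply: ln_ge0; lra.
have q0 : 0 < 1 - (t ^+ 2)^-1 by lra.
have l1 : - ln (1 - (t ^+ 2)^-1) <= 2 * (t ^+ 2)^-1.
  have := ln_le_subr1 (_ : 0 < (1 - (t ^+ 2)^-1)^-1); rewrite invr_gt0 => /(_ q0).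
  rewrite lnV ?posrE // => h; apply: le_trans h _.
  rewrite lerBlDr -div1r ler_pdivrMr //; set e := (t ^+ 2)^-1 in e0 e4 *; nra.
have l2 : p * (ln t *+ 2) <= 2 / t.
  apply: (@le_trans _ _ ((t ^+ 2)^-1 * (t *+ 2))).
    by apply: ler_pM => //; lra.
  by rewrite (_ : _ * _ = 2 / t) //; field; rewrite gt_eqF.
have l3 : - (1 - p) * ln (1 - (t ^+ 2)^-1) <= 2 * (t ^+ 2)^-1.
  rewrite mulNr -mulrN; apply: le_trans l1.
  have : 0 <= - ln (1 - (t ^+ 2)^-1) by rewrite oppr_ge0 ln_le0 //; lra.
  move: (- ln _) => y y0; nra.
have l4 : 2 * (t ^+ 2)^-1 <= 1 / t.
  rewrite -ler_pdivlMl // [leRHS](_ : _ = (t * 2)^-1); last by field; rewrite gt_eqF.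
  rewrite lef_pV2 ?posrE ?mulr_gt0 //; nra.
have : 0 < t^-1 by rewrite invr_gt0.
lra.
Qed.

End BinaryEntropy.

(** * Conditional entropy in a family of sets *)

Section FamilyEntropy.
Import mathcomp.boot.fintype mathcomp.boot.finset.
Local Open Scope ring_scope.
Local Open Scope set_scope.
Variables (R : realType) (P : finType) (Om : {set {set P}}).
Implicit Types (A B D F J w : {set P}) (e : P).

Definition fiber A w : {set {set P}} :=
  [set w' in Om | w' :&: A == w :&: A].

Definition cprob A e w : R :=
  #|[set w' in fiber A w | e \in w']|%:R / #|fiber A w|%:R.

(* [centropy A e] is [#|Om|] times the entropy of the bit [e \in w],
   conditional on [w :&: A], when [w] is uniform in [Om]; [log_fiber A] is
   [#|Om|] times the entropy of [w] conditional on [w :&: A]. *)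
Definition centropy A e : R := \sum_(w in Om) nat_entropy (cprob A e w).

Definition log_fiber A : R := \sum_(w in Om) ln (#|fiber A w|%:R : R).

Lemma fiber_refl A w : w \in Om -> w \in fiber A w.
Proof. by rewrite inE eqxx andbT. Qed.

Lemma fiber_eq A w w' : w' \in fiber A w -> fiber A w' = fiber A w.
Proof. by rewrite inE => /andP[_ /eqP h]; apply/setP => v; rewrite !inE h. Qed.

Lemma fiberS A B w : A \subset B -> fiber B w \subset fiber A w.
Proof.
move=> AB; apply/subsetP => v; rewrite !inE => /andP[-> /eqP h] /=.
by rewrite -(setIidPr AB) !setIA h.
Qed.

Lemma fiber_gt0 A w : w \in Om -> 0 < (#|fiber A w|%:R : R).
Proof. by move=> h; rewrite ltr0n; apply/card_gt0P; exists w; exact: fiber_refl. Qed.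

Lemma cprob_eq A e w w' : w' \in fiber A w -> cprob A e w' = cprob A e w.
Proof. by move=> h; rewrite /cprob (fiber_eq h). Qed.

Lemma cprob_bounds A e w : 0 <= cprob A e w <= 1.
Proof.
rewrite /cprob divr_ge0 //=; have [->|n0] := posnP #|fiber A w|.
  by rewrite invr0 mulr0.
rewrite ler_pdivrMr ?ltr0n // mul1r ler_nat subset_leq_card //.
by apply/subsetP => v; rewrite inE => /andP[].
Qed.

(** Law of total expectation: each [w'] lies in the fibers of exactly [#|fiber A w'|] members of
    [Om], which cancels the denominator. *)
Lemma sum_fiber A (psi : {set P} -> R) :
  \sum_(w in Om) psi w =
  \sum_(w in Om) (\sum_(w' in fiber A w) psi w') / #|fiber A w|%:R.
Proof.
under [RHS]eq_bigr do rewrite mulr_suml.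
rewrite (exchange_big_dep (mem Om)) /=; last by move=> w w' _; rewrite inE => /andP[].
apply: eq_bigr => w wO.
rewrite (eq_bigr (fun=> psi w / #|fiber A w|%:R)); last first.
  by move=> w' /andP[_ h]; rewrite (fiber_eq h).
rewrite sumr_const [X in _ *+ X](_ : _ = #|fiber A w|).
  by rewrite -[RHS]mulr_natr divfK // gt_eqF ?fiber_gt0.
by apply: eq_card => v; rewrite [LHS]unfold_in /= !inE wO /= eq_sym.
Qed.

Definition fiber_invariant A (psi : {set P} -> R) :=
  forall w w', w \in Om -> w' \in fiber A w -> psi w' = psi w.

Lemma tower A e psi : fiber_invariant A psi ->
  \sum_(w in Om | e \in w) psi w = \sum_(w in Om) cprob A e w * psi w.
Proof.
move=> inv; rewrite big_mkcondr (sum_fiber A); apply: eq_bigr => w wO.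
rewrite mulrAC; congr (_ / _); rewrite -big_mkcondr /=.
rewrite (eq_bigr (fun=> psi w)) => [|w' /andP[h _]]; last exact: inv.
rewrite sumr_const -[LHS]mulr_natl; congr (_%:R * _).
by apply: eq_card => v; rewrite [LHS]unfold_in /= !inE.
Qed.

Lemma towerN A e psi : fiber_invariant A psi ->
  \sum_(w in Om | e \notin w) psi w = \sum_(w in Om) (1 - cprob A e w) * psi w.
Proof.
move=> inv; apply: (addrI (\sum_(w in Om | e \in w) psi w)).
rewrite -bigID /= (tower e inv) -big_split /=.
by apply: eq_bigr => w _; rewrite -mulrDl subrKC mul1r.
Qed.

(** Supplies the two side conditions of [gibbs] for comparing the law given [B] with the law given
    [A]; both hold because the finer fiber is a subset of the coarser one. *)
Lemma cprobS A B e w : A \subset B -> w \in Om ->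
  (cprob A e w = 0 -> cprob B e w = 0) /\ (cprob A e w = 1 -> cprob B e w = 1).
Proof.
move=> AB wO; have gA := fiber_gt0 A wO; have gB := fiber_gt0 B wO.
have sub := fiberS w AB.
split; rewrite /cprob => /eqP.
  rewrite mulf_eq0 invr_eq0 (gt_eqF gA) orbF pnatr_eq0 cards_eq0 => /eqP h.
  rewrite (_ : [set w' in fiber B w | e \in w'] = set0) ?cards0 ?mul0r //.
  apply/setP => v; rewrite !inE; apply/negbTE; apply/negP => /andP[hv ev].
  have : v \in [set w' in fiber A w | e \in w'].
    by rewrite inE ev andbT; apply: (subsetP sub); rewrite inE.
  by rewrite h inE.
move=> /eqP h; have {}h : [set w' in fiber A w | e \in w'] = fiber A w.
  apply/eqP; rewrite eqEcard; apply/andP; split.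
    by apply/subsetP => v; rewrite inE => /andP[].
  rewrite -(ler_nat R).
  by rewrite (divr1_eq h).
rewrite (_ : [set w' in fiber B w | e \in w'] = fiber B w) ?divff ?gt_eqF //.
apply/setP => v; rewrite inE; case: (boolP (v \in fiber B w)) => //= hv.
by have := subsetP sub _ hv; rewrite -h inE => /andP[].
Qed.

Lemma fiber_invariantS A B psi : A \subset B ->
  fiber_invariant A psi -> fiber_invariant B psi.
Proof. by move=> AB inv w w' wO h; apply: inv => //; apply: subsetP (fiberS w AB) _ h. Qed.

Lemma fiber_invariant_cprob A e (f : R -> R) :
  fiber_invariant A (fun w => f (cprob A e w)).
Proof. by move=> w w' _ h; rewrite (cprob_eq e h). Qed.

(** By [tower] and [towerN], both sides are the sum of [f] over the [w] containing [e] plus that of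
    [g] over the others. This lets a cross-entropy trade [B] for [A]. *)
Lemma sum_cross A B e (f g : {set P} -> R) : A \subset B ->
  fiber_invariant A f -> fiber_invariant A g ->
  \sum_(w in Om) (cprob B e w * f w + (1 - cprob B e w) * g w) =
  \sum_(w in Om) (cprob A e w * f w + (1 - cprob A e w) * g w).
Proof.
move=> AB hf hg; rewrite !big_split /=.
rewrite -(tower e (fiber_invariantS AB hf)) -(towerN e (fiber_invariantS AB hg)).
by rewrite -(tower e hf) -(towerN e hg).
Qed.

(** With [f] and [g] the log-losses of the law given [A], [sum_cross] turns [centropy A e] into the
    cross-entropy of the finer law against the coarser one, and Gibbs' inequality applies. *)
Lemma centropyS A B e : A \subset B -> centropy B e <= centropy A e.
Proof.
move=> AB.
pose f w := - ln (cprob A e w); pose g w := - ln (1 - cprob A e w).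
have hf : fiber_invariant A f by exact: (@fiber_invariant_cprob A e (fun x => - ln x)).
have hg : fiber_invariant A g.
  exact: (@fiber_invariant_cprob A e (fun x => - ln (1 - x))).
have -> : centropy A e =
    \sum_(w in Om) (cprob A e w * f w + (1 - cprob A e w) * g w).
  by apply: eq_bigr => w _; rewrite /nat_entropy /f /g; ring.
rewrite -(sum_cross e AB hf hg); apply: ler_sum => w wO.
have [h0 h1] := cprobS e AB wO.
apply: le_trans (gibbs (cprob_bounds B e w) (cprob_bounds A e w) h0 h1) _.
by rewrite /f /g; lra.
Qed.

Lemma centropy_le A e : centropy A e <= #|Om|%:R * ln 2.
Proof.
rewrite mulr_natl -[leRHS]sumr_const; apply: ler_sum => w _.
exact: nat_entropy_le_ln2 (cprob_bounds _ _ _).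
Qed.

Lemma centropy_ge0 A e : 0 <= centropy A e.
Proof. by apply: sumr_ge0 => w _; exact: nat_entropy_ge0 (cprob_bounds _ _ _). Qed.

Definition outcome_prob A e w J : R :=
  if e \in J then cprob A e w else 1 - cprob A e w.

Lemma outcome_prob_ge0 A e w J : 0 <= outcome_prob A e w J.
Proof. by have /andP[] := cprob_bounds A e w; rewrite /outcome_prob; case: ifP => _; lra. Qed.

Lemma fiberU1 A e w : w \in Om ->
  (#|fiber (e |: A) w|%:R : R) = outcome_prob A e w w * #|fiber A w|%:R.
Proof.
move=> wO; have g := fiber_gt0 A wO.
have E v : (v :&: (e |: A) == w :&: (e |: A)) =
    (v :&: A == w :&: A) && ((e \in v) == (e \in w)).
  apply/eqP/andP => [h|[/eqP h /eqP h']].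
    split; last by have /setP/(_ e) := h; rewrite !inE eqxx !andbT => ->.
    have sA : A \subset e |: A by exact: subsetUr.
    by rewrite -(setIidPr sA) !setIA h.
  apply/setP => x; rewrite !inE; have [->|ne] /= := eqVneq x e.
    by rewrite !andbT h'.
  by have /setP/(_ x) := h; rewrite !inE.
have fE : fiber (e |: A) w = [set v in fiber A w | (e \in v) == (e \in w)].
  by apply/setP => v; rewrite !inE E andbA.
have split1 : #|fiber A w| = (#|[set v in fiber A w | e \in v]| +
    #|[set v in fiber A w | e \notin v]|)%N.
  rewrite -[LHS](cardsID [set v : {set P} | e \in v]); congr (_ + _)%N; apply: eq_card => v.
    by rewrite !inE.
  by rewrite !inE andbC.
rewrite fE /outcome_prob /cprob; case: ifP => ew.
  rewrite divfK ?gt_eqF //; congr (_%:R).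
  by apply: eq_card => v; rewrite !inE eqb_id.
rewrite mulrBl mul1r divfK ?gt_eqF // split1 natrD addrC addKr; congr (_%:R).
by apply: eq_card => v; rewrite !inE eqbF_neg.
Qed.

Lemma outcome_prob_gt0 A e w : w \in Om -> 0 < outcome_prob A e w w.
Proof.
move=> wO; have := fiber_gt0 (e |: A) wO.
by rewrite fiberU1 // pmulr_lgt0 // fiber_gt0.
Qed.

Lemma sum_ln_outcome A e :
  \sum_(w in Om) ln (outcome_prob A e w w) = - centropy A e.
Proof.
rewrite (bigID (fun w => e \in w)) /= /outcome_prob.
rewrite (eq_bigr (fun w => ln (cprob A e w))); last by move=> w /andP[_ ->].
rewrite [X in _ + X](eq_bigr (fun w => ln (1 - cprob A e w))); last first.
  by move=> w /andP[_ /negbTE->].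
rewrite (tower e (@fiber_invariant_cprob A e (fun x => ln x))).
rewrite (towerN e (@fiber_invariant_cprob A e (fun x => ln (1 - x)))).
rewrite -big_split -sumrN; apply: eq_bigr => w _ /=.
by rewrite /nat_entropy; ring.
Qed.

(** The chain rule for entropy: the fiber shrinks by the factor [outcome_prob A e w w], whose
    logarithms sum to minus the entropy of the bit. *)
Lemma log_fiber_chain A e : log_fiber A - log_fiber (e |: A) = centropy A e.
Proof.
rewrite -[RHS]opprK -sum_ln_outcome -!sumrN -big_split /=.
apply: eq_bigr => w wO; rewrite fiberU1 // lnM ?posrE ?fiber_gt0 ?outcome_prob_gt0 //.
ring.
Qed.

Lemma set_ind_add (Q : {set P} -> Prop) : Q set0 ->
  (forall e D, e \notin D -> Q D -> Q (e |: D)) -> forall D, Q D.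
Proof.
move=> Q0 QS D; have [n] := ubnP #|D|; elim: n => // n IH in D *.
have [->//|[e eD]] := set_0Vmem D; rewrite ltnS => Dn.
rewrite -(setD1K eD); apply: QS; first by rewrite !inE eqxx.
by apply: IH; apply: leq_trans Dn; rewrite (cardsD1 e D) eD.
Qed.

Lemma log_fiber_drop_le A D (c : P -> R) :
  (forall e D', e \in D -> D' \subset D -> centropy (A :|: D') e <= c e) ->
  log_fiber A - log_fiber (A :|: D) <= \sum_(e in D) c e.
Proof.
elim/set_ind_add: D => [|e D eD IH] h; first by rewrite setU0 subrr big_set0.
rewrite big_setU1 //= setUCA; have sD : D \subset e |: D by exact: subsetUr.
have := log_fiber_chain (A :|: D) e.
have := h e D (setU11 _ _) sD.
have := IH (fun e' D' he hD => h e' D' (subsetP sD _ he) (subset_trans hD sD)).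
lra.
Qed.

(** The bits of [D] are revealed one at a time by the chain rule. A bit already revealed has entropy
    zero, so here [D'] must leave out [e], unlike in [log_fiber_drop_le]. *)
Lemma log_fiber_drop_ge A D (c : P -> R) :
  (forall e D', e \in D -> D' \subset D :\ e -> c e <= centropy (A :|: D') e) ->
  \sum_(e in D) c e <= log_fiber A - log_fiber (A :|: D).
Proof.
elim/set_ind_add: D => [|e D eD IH] h; first by rewrite setU0 subrr big_set0.
rewrite big_setU1 //= setUCA; have sD : D \subset e |: D by exact: subsetUr.
have := log_fiber_chain (A :|: D) e.
have := h e D (setU11 _ _); rewrite setU1K // => /(_ (subxx _)).
have := IH (fun e' D' he hD => h e' D' (subsetP sD _ he) (subset_trans hD (setSD _ sD))).
lra.
Qed.

Lemma sum_outcomes (p : P -> R) D :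
  \sum_(J in powerset D) \prod_(e in D) (if e \in J then p e else 1 - p e) = 1.
Proof.
transitivity (\prod_(e in D) (p e + (1 - p e))); last first.
  by rewrite big1 // => e _; rewrite subrKC.
rewrite [RHS]big_mkcond /= [RHS](eq_bigr (fun e => (if e \in D then p e else 0) +
  (if e \in D then 1 - p e else 1))); last by move=> e _; case: (e \in D); rewrite ?add0r.
rewrite bigA_distr [LHS]big_mkcond [RHS]big_mkcond /=; apply: eq_bigr => J _.
rewrite powersetE; case: ifP => [/subsetP JD|/negbT /subsetPn[e eJ eD]].
  rewrite big_mkcond; apply: eq_bigr => e _.
  by case: ifP => eD; case: ifP => // eJ; rewrite (JD e eJ) in eD.
by rewrite (bigD1 e) //= eJ (negbTE eD) mul0r.
Qed.

(* The left-hand side is [#|Om|] times the probability of the outcome [J0]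
   under the product of the conditional laws of the bits of [D] given
   [w :&: F]; the right-hand side is the divergence of the true joint
   conditional law, to which [J0] is impossible, from this product. *)
Lemma missing_outcome F D J0 : J0 \subset D ->
  (forall w, w \in Om -> w :&: D != J0) ->
  \sum_(w in Om) \prod_(e in D) outcome_prob F e w J0 <=
  \sum_(e in D) centropy F e - (log_fiber F - log_fiber (F :|: D)).
Proof.
move=> J0D missing.
pose mu w J := \prod_(e in D) outcome_prob F e w J.
have mu_ge0 w J : 0 <= mu w J by apply: prodr_ge0 => e _; exact: outcome_prob_ge0.
(* The product law divided by the true conditional probability of the outcome [w :&: D], which is a
   quotient of fiber sizes. *)
pose ratio w := mu w w * (#|fiber F w|%:R / #|fiber (F :|: D) w|%:R).
have mugt0 w : w \in Om -> 0 < mu w w.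
  by move=> wO; apply: prodr_gt0 => e _; exact: outcome_prob_gt0.
have ln_ratio : \sum_(w in Om) ln (ratio w) =
    - \sum_(e in D) centropy F e + (log_fiber F - log_fiber (F :|: D)).
  transitivity (\sum_(w in Om) (\sum_(e in D) ln (outcome_prob F e w w) +
      (ln (#|fiber F w|%:R : R) - ln (#|fiber (F :|: D) w|%:R : R)))).
    apply: eq_bigr => w wO; rewrite /ratio lnM ?posrE ?mugt0 ?divr_gt0 ?fiber_gt0 //.
    rewrite ln_div ?posrE ?fiber_gt0 //; congr (_ + _).
    rewrite /mu; elim/set_ind_add: D {J0D missing mu mu_ge0 ratio mugt0} => [|e D eD IH].
      by rewrite !big_set0 ln1.
    rewrite !big_setU1 //= lnM ?posrE ?outcome_prob_gt0 ?IH //.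
    by apply: prodr_gt0 => e' _; exact: outcome_prob_gt0.
  rewrite big_split /= exchange_big /= big_split /= sumrN; congr (_ + _).
  by rewrite -sumrN; apply: eq_bigr => e _; rewrite sum_ln_outcome.
(* By $\ln x \le x - 1$ it suffices to bound the mean of [ratio]; on a fiber this is the product
   mass of the outcomes that occur, and [J0] is not among them. *)
suff : \sum_(w in Om) ratio w <= \sum_(w in Om) (1 - mu w J0).
  have : \sum_(w in Om) ln (ratio w) <= \sum_(w in Om) (ratio w - 1).
    apply: ler_sum => w wO; apply: ln_le_subr1.
    by rewrite mulr_gt0 ?mugt0 ?divr_gt0 ?fiber_gt0.
  by rewrite ln_ratio !big_split /= !sumrN /mu; lra.
rewrite (sum_fiber F); apply: ler_sum => w wO.
have gF := fiber_gt0 F wO.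
have muE w' J : w' \in fiber F w -> mu w' J = mu w J.
  by move=> h; apply: eq_bigr => e _; rewrite /outcome_prob (cprob_eq e h).
have muI J : mu w J = mu w (J :&: D).
  by apply: eq_bigr => e eD; rewrite /outcome_prob inE eD andbT.
have -> : (\sum_(w' in fiber F w) ratio w') / #|fiber F w|%:R =
    \sum_(w' in fiber F w) mu w (w' :&: D) / #|fiber (F :|: D) w'|%:R.
  rewrite mulr_suml; apply: eq_bigr => w' h.
  rewrite /ratio muE // -muI (fiber_eq h); field.
  by rewrite (gt_eqF gF) gt_eqF // fiber_gt0 //; move: h; rewrite inE => /andP[].
rewrite (partition_big (fun w' => w' :&: D) (mem (powerset D))) /=; last first.
  by move=> w' _; rewrite powersetE subsetIr.
rewrite -[X in _ <= X - _](sum_outcomes (fun e => cprob F e w) D).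
rewrite [leLHS](bigD1 J0) /= ?powersetE //= big1 ?add0r; last first.
  move=> w'; rewrite inE => /andP[/andP[wO' _] /eqP h].
  by have := missing _ wO'; rewrite h eqxx.
rewrite [X in _ <= X - _](bigD1 J0) /= ?powersetE //=.
rewrite [X in _ <= X - _]addrC addrK; apply: ler_sum => J /andP[JD _].
rewrite (eq_bigr (fun=> mu w J /
   #|[set v in fiber F w | v :&: D == J]|%:R)); last first.
  move=> w' /andP[h /eqP hJ]; rewrite hJ; congr (_ / _%:R).
  apply: eq_card => v; move: h; rewrite !inE => /andP[_ /eqP h].
  apply/idP/idP => [/andP[-> /eqP E]|/andP[/andP[-> /eqP E] /eqP EJ]] /=.
    apply/andP; split.
      have s : F \subset F :|: D by exact: subsetUl.
      by rewrite -h -(setIidPr s) !setIA E.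
    have s : D \subset F :|: D by exact: subsetUr.
    by rewrite -hJ -(setIidPr s) !setIA E.
  by rewrite !setIUr E h EJ hJ.
rewrite sumr_const [X in _ *+ X](_ : _ = #|[set v in fiber F w | v :&: D == J]|); last first.
  by apply: eq_card => v; rewrite [LHS]unfold_in /= !inE.
rewrite -[leLHS]mulr_natr; set c := #|_|; have [->|c0] := posnP c; first by rewrite mulr0; exact: (mu_ge0 w J).
by rewrite divfK // pnatr_eq0 -lt0n.
Qed.

Lemma sum_cprob A e :
  \sum_(w in Om) cprob A e w = #|[set w in Om | e \in w]|%:R.
Proof.
have := @tower A e (fun=> 1) (fun _ _ _ _ => erefl).
rewrite sumr_const -[_ *+ _]/(_%:R) => h; rewrite (_ : #|_| = #|[set w in Om | e \in w]|) in h.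
  by rewrite h; apply: eq_bigr => w _; rewrite mulr1.
by apply: eq_card => v; rewrite [LHS]unfold_in /= !inE.
Qed.

(** * Invariance of conditional entropy under symmetries of the family *)

Section Relabeling.
Variable t : P -> P.
Hypothesis t_inj : injective t.
Hypothesis t_Om : forall w, w \in Om -> t @: w \in Om.

Let im_inj : injective (fun w : {set P} => t @: w).
Proof. exact: imset_inj. Qed.

Lemma relabel_Om : (fun w : {set P} => t @: w) @: Om = Om.
Proof.
apply/eqP; rewrite eqEcard card_imset // leqnn andbT.
by apply/subsetP => _ /imsetP[w wO ->]; exact: t_Om.
Qed.

Lemma fiber_relabel A w : fiber (t @: A) (t @: w) = (fun v : {set P} => t @: v) @: fiber A w.
Proof.
apply/setP => v; apply/idP/imsetP => [|[u + ->]]; rewrite inE.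
  case/andP; rewrite -{1}relabel_Om => /imsetP[u uO ->].
  rewrite -!(imsetI (in2W t_inj)) (inj_eq im_inj) => h.
  by exists u => //; rewrite inE uO.
by move=> /andP[uO /eqP h]; rewrite !inE t_Om //= -!(imsetI (in2W t_inj)) h.
Qed.

Lemma cprob_relabel A e w : cprob (t @: A) (t e) (t @: w) = cprob A e w.
Proof.
rewrite /cprob fiber_relabel card_imset //; congr (_%:R / _).
rewrite -[RHS](card_imset _ im_inj); apply: eq_card => v; rewrite inE.
apply/andP/imsetP => [[/imsetP[u uO ->]]|[u + ->]].
  by rewrite mem_imset // => eu; exists u => //; rewrite inE uO.
by rewrite inE => /andP[h eu]; rewrite !mem_imset.
Qed.

Lemma centropy_relabel A e : centropy (t @: A) (t e) = centropy A e.
Proof.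
rewrite /centropy -{1}relabel_Om big_imset /=; last exact: in2W im_inj.
by apply: eq_bigr => w _; rewrite cprob_relabel.
Qed.

Lemma card_mem_relabel e :
  #|[set w in Om | t e \in w]| = #|[set w in Om | e \in w]|.
Proof.
rewrite -[RHS](card_imset _ im_inj); apply: eq_card => v; rewrite inE.
apply/andP/imsetP => [[]|[u + ->]].
  by rewrite -{1}relabel_Om => /imsetP[u uO ->]; rewrite mem_imset // => eu; exists u => //; rewrite inE uO.
by rewrite inE => /andP[h eu]; rewrite t_Om // mem_imset.
Qed.

End Relabeling.

End FamilyEntropy.

(** * Templates without claws *)

Section ThreeColourings.
Import mathcomp.boot.fintype mathcomp.boot.finset.
Local Open Scope nat_scope.
Local Open Scope set_scope.
Variable V : finType.
Implicit Types (A Q : {set V}) (e : {set V}) (x y : V).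

Definition pairs A : {set {set V}} := [set e : {set V} | (e \subset A) && (#|e| == 2)].

Lemma pairs2 A x y : x \in A -> y \in A -> x != y -> [set x; y] \in pairs A.
Proof. by move=> xA yA xy; rewrite inE cards2 xy andbT subUset !sub1set xA. Qed.

Lemma set2_inj x : {in predC1 x &, injective (fun y => [set x; y])}.
Proof.
move=> y z yx _ /setP/(_ y); rewrite !inE eqxx orbT => /esym/orP[] /eqP //.
by move=> h; rewrite inE h /= eqxx in yx.
Qed.

Lemma pairsP A e : reflect (exists x y, [/\ x \in A, y \in A, x != y & e = [set x; y]])
  (e \in pairs A).
Proof.
apply: (iffP idP) => [|[x [y [xA yA xy ->]]]]; last exact: pairs2.
rewrite inE => /andP[/subsetP eA /cards2P[x [y [xy E]]]].
by exists x, y; split=> //; apply: eA; rewrite E !inE eqxx ?orbT.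
Qed.

Lemma sum_pairs_rem A x (f : {set V} -> nat) : x \in A ->
  \sum_(e in pairs A) f e =
  \sum_(e in pairs (A :\ x)) f e + \sum_(y in A :\ x) f [set x; y].
Proof.
move=> xA; rewrite (bigID (fun e : {set V} => x \notin e)) /=; congr (_ + _).
  by apply: eq_bigl => e; rewrite !inE subsetD1 -!andbA; congr (_ && _); rewrite andbC.
rewrite -(big_imset (h := fun y => [set x; y]) f); last first.
  by move=> y z; rewrite !inE => /andP[yx _] /andP[zx _]; apply: set2_inj; rewrite inE.
apply: eq_bigl => e; rewrite negbK; apply/andP/imsetP.
  move=> [/pairsP[a [b [aA bA ab ->]]]]; rewrite !inE => /orP[] /eqP->.
    by exists b => //; rewrite !inE bA andbT eq_sym.
  by exists a; rewrite 1?setUC // !inE aA andbT.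
move=> [y]; rewrite !inE => /andP[yx yA ->]; split; last by rewrite !inE eqxx.
by have := pairs2 xA yA; rewrite eq_sym inE => /(_ yx).
Qed.

(* [nonwhite e] and [nonblack e]: the pair [e] may be an edge, resp. a non-edge. *)
Variables (nonwhite nonblack : {set V} -> bool).
Hypothesis coloured : forall e, nonwhite e || nonblack e.

Definition grey e := nonwhite e && nonblack e.
Definition black e := ~~ nonblack e.

Definition no_claw A := forall c x y z, c \in A -> x \in A -> y \in A -> z \in A ->
  uniq [:: c; x; y; z] ->
  nonwhite [set c; x] -> nonwhite [set c; y] -> nonwhite [set c; z] ->
  nonblack [set x; y] -> nonblack [set x; z] -> nonblack [set y; z] -> False.

Definition black_clique A Q :=
  (Q \subset A) && [forall x in Q, forall y in Q, (x != y) ==> black [set x; y]].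

Definition grey_deg A x := \sum_(y in A :\ x) grey [set x; y].
Definition black_deg A x := \sum_(y in A :\ x) black [set x; y].

(* The vertices joined to [x] by a non-white pair and to [v] by a non-black pair
   form a black clique: together with [v] they are candidates for the leaves of
   a claw centred at [x]. *)
Lemma link_clique A x v : no_claw A -> x \in A -> v \in A -> x != v ->
  nonwhite [set x; v] ->
  black_clique A [set y in A :\ x :\ v | nonwhite [set x; y] && nonblack [set v; y]].
Proof.
move=> noc xA vA xv wxv; apply/andP; split.
  by apply/subsetP => y; rewrite !inE => /andP[/andP[_ /andP[_ ->]]].
apply/forallP => y; apply/implyP; rewrite !inE => /andP[/and3P[yv yx yA] /andP[wy by_]].
apply/forallP => z; apply/implyP; rewrite !inE => /andP[/and3P[zv zx zA] /andP[wz bz]].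
apply/implyP => yz; apply/negP => nyz; apply: (noc x v y z) => //=.
by rewrite !inE !negb_or xv yz !(eq_sym x) !(eq_sym v) yx zx yv zv.
Qed.

(** Bookkeeping for deleting [x] and [v] in [grey_le_black]: [gx] counts the grey pairs at [x] other
    than the one to [v]. The surplus of grey over black pairs is at most four, two for each deleted
    vertex. *)
Lemma pair_removal_arith (gx gv bx bv c1 c2 q G B a : nat) :
  gx + gx + gv + bx <= bv + c1 + c1 + c2 -> c1 <= q -> c2 <= q -> q <= bx.+1 ->
  bx < gx.+1 -> G <= B + 2 * a ->
  G + gv + gx.+1 <= B + bv + bx + (2 * 1 + (2 * 1 + 2 * a)).
Proof. by lia. Qed.

(** Induction on [A]. Let [x] lie in a largest black clique [Q]; delete [x] if its grey degree does
    not exceed its black degree, and otherwise delete [x] with a grey neighbour [v]. In the second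
    case [link_clique] bounds the links by [#|Q|], hence by the black degree of [x] plus one. *)
Lemma grey_le_black A : no_claw A ->
  \sum_(e in pairs A) grey e <= \sum_(e in pairs A) black e + 2 * #|A|.
Proof.
have [n] := ubnP #|A|; elim: n => // n IH in A *; rewrite ltnS => An noc.
have IHS A' x : x \in A -> A' \subset A :\ x ->
    \sum_(e in pairs A') grey e <= \sum_(e in pairs A') black e + 2 * #|A'|.
  move=> xA sA'; apply: IH.
    apply: leq_trans An; apply: leq_ltn_trans (subset_leq_card sA') _.
    by rewrite [X in _ < X](cardsD1 x) xA.
  have /subsetP sA : A' \subset A by apply: subset_trans sA' (subD1set _ _).
  by move=> c a b d /sA hc /sA ha /sA hb /sA hd; exact: noc.
have [A0|[x0 x0A]] := set_0Vmem A.
  rewrite big1 // => e /pairsP[x [y []]]; by rewrite A0 inE.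
have cl0 : black_clique A set0.
  by rewrite /black_clique sub0set; apply/forallP => x; rewrite inE.
case: (@arg_maxnP _ _ (black_clique A) (fun Q => #|Q|) cl0) => Q clQ Qmax.
have [x xQ] : exists x, x \in Q.
  apply/set0Pn; rewrite -card_gt0; apply: leq_trans (Qmax [set x0] _).
    by rewrite cards1.
  rewrite /black_clique sub1set x0A; apply/forallP => y; apply/implyP; rewrite inE => /eqP->.
  by apply/forallP => z; apply/implyP; rewrite inE => /eqP->; rewrite eqxx.
have /andP[/subsetP QA /forallP Qb] := clQ.
have xA := QA _ xQ.
have qb : #|Q| <= (black_deg A x).+1.
  rewrite (cardsD1 x) xQ ltnS /black_deg -sum1_card.
  rewrite [leqRHS](bigID (mem Q)) /=; apply: leq_trans (leq_addr _ _).
  rewrite (eq_bigl (fun y => (y \in A :\ x) && (y \in Q))); last first.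
    by move=> y; rewrite !inE; case: (boolP (y \in Q)) => yQ; rewrite ?andbF // QA // !andbT.
  apply: leq_sum => y /andP[]; rewrite !inE => /andP[yx _] yQ.
  have /implyP/(_ xQ)/forallP/(_ y)/implyP/(_ yQ)/implyP := Qb x.
  by rewrite eq_sym => /(_ yx) ->.
have rem y B (f : {set V} -> bool) := @sum_pairs_rem B y f.
have [gb|gb] := leqP (grey_deg A x) (black_deg A x).
  have := IHS _ x xA (subxx _); rewrite (rem x A grey) // (rem x A black) //.
  by rewrite -/(grey_deg A x) -/(black_deg A x) [#|A|](cardsD1 x) xA; lia.
have [v vAx gxv] : exists2 v, v \in A :\ x & grey [set x; v].
  case: (pickP (fun v => (v \in A :\ x) && grey [set x; v])) => [v /andP[]|h]; first by exists v.
  have : grey_deg A x = 0; last lia.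
  by rewrite /grey_deg big1 // => y yA; have := h y; rewrite yA /= => ->.
have := vAx; rewrite !inE => /andP[vx vA].
have xv : x != v by rewrite eq_sym.
have /andP[wxv bxv] := gxv.
have c1 : _ <= #|Q| := Qmax _ (link_clique noc xA vA xv wxv).
have c2 : #|[set y in A :\ v :\ x | nonwhite [set v; y] && nonblack [set x; y]]| <= #|Q|.
  by apply: Qmax; apply: link_clique => //; rewrite setUC.
rewrite setDDl setUC -setDDl in c2.
have bF : black [set x; v] = false by rewrite /black bxv.
have gx : grey_deg A x = (\sum_(y in A :\ x :\ v) grey [set x; y]).+1.
  by rewrite /grey_deg (big_setD1 v) //= gxv.
have bx : black_deg A x = \sum_(y in A :\ x :\ v) black [set x; y].
  by rewrite /black_deg (big_setD1 v) //= bF.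
(* Checked colour by colour for the pairs from [y] to [x] and to [v]; the indicators on the right
   count the links of [c1] and [c2]. One of the two copies of the grey degree of [x] is later traded
   for its black degree. *)
have pw : \sum_(y in A :\ x :\ v) (grey [set x; y] + grey [set x; y] + grey [set v; y] + black [set x; y])
  <= \sum_(y in A :\ x :\ v) (black [set v; y] +
       (nonwhite [set x; y] && nonblack [set v; y]) +
       (nonwhite [set x; y] && nonblack [set v; y]) +
       (nonwhite [set v; y] && nonblack [set x; y])).
  apply: leq_sum => y _; rewrite /grey /black.
  have := coloured [set x; y]; have := coloured [set v; y].
  by do 4 case: (_ [set _; y]).
rewrite !big_split /= in pw.
have card_sum (f : pred V) : \sum_(y in A :\ x :\ v) f y = #|[set y in A :\ x :\ v | f y]|.
  rewrite -sum1_card -[LHS]big_mkcondr /=; apply: eq_bigl => y.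
  by rewrite !inE.
rewrite (card_sum (fun y => nonwhite [set x; y] && nonblack [set v; y])) in pw.
rewrite (card_sum (fun y => nonwhite [set v; y] && nonblack [set x; y])) in pw.
have := IHS (A :\ x :\ v) x xA (subD1set _ _).
rewrite (rem x A grey) // (rem x A black) // (rem v (A :\ x) grey) // (rem v (A :\ x) black) //.
rewrite -/(grey_deg A x) -/(black_deg A x) [#|A|](cardsD1 x) xA [#|A :\ x|](cardsD1 v) vAx.
move: qb gb; rewrite bx gx !mulnDr; exact: (pair_removal_arith pw c1 c2).
Qed.

End ThreeColourings.

(** * Graphs and relabelling *)

Section ClawFree.
Import mathcomp.boot.fintype mathcomp.boot.finset.
Local Open Scope nat_scope.
Local Open Scope set_scope.

Lemma perm_extend (T : finType) (s t : seq T) : uniq s -> uniq t -> size s = size t ->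
  exists sg : {perm T}, map sg s = t.
Proof.
elim: s t => [|x s IH] [|y t] //=; first by exists 1%g.
move=> /andP[xs us] /andP[yt ut] [] /(IH _ us ut)[sg st].
have sx : sg x \notin t by rewrite -st mem_map //; exact: perm_inj.
exists (sg * tperm (sg x) y)%g; rewrite permM tpermL; congr (_ :: _).
rewrite -[RHS]st; apply/eq_in_map => z zs; rewrite permM tpermD //.
  by rewrite (inj_eq perm_inj); apply: contraNneq xs => ->.
by apply: contraNneq yt => ->; rewrite -st map_f.
Qed.

Variable V : finType.
Implicit Types (E : {set {set V}}) (S U e : {set V}).

(** Trades the embedding of [claw] for its four image vertices; simplicity ensures that an edge
    inside the image is one of the six pairs. *)
Lemma claw_freeP E : simple_graph E ->
  claw_free E <-> forall c x y z, uniq [:: c; x; y; z] ->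
    [set c; x] \in E -> [set c; y] \in E -> [set c; z] \in E ->
    [set x; y] \notin E -> [set x; z] \notin E -> [set y; z] \notin E -> False.
Proof.
move=> /forallP simp; split=> [|noc].
  move=> /negP cf c x y z un cx cy cz xy xz yz; apply: cf.
  pose f : {ffun 'I_4 -> V} := [ffun i : 'I_4 => nth c [:: c; x; y; z] i].
  have finj : injective f.
    move=> i j; rewrite !ffunE => /eqP; rewrite nth_uniq //; last first.
    by move=> /eqP /val_inj.
  apply/existsP; exists f; apply/andP; split; first by apply/injectiveP.
  apply/eqP/setP => e; rewrite inE; apply/andP/imsetP.
    move=> [eE /subsetP sub].
    have /implyP/(_ eE)/cards2P[a [b [ab ee]]] := simp e.
    have /imsetP[i _ ai] : a \in f @: [set: 'I_4] by apply: sub; rewrite ee !inE eqxx.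
    have /imsetP[j _ bj] : b \in f @: [set: 'I_4] by apply: sub; rewrite ee !inE eqxx orbT.
    have ij : i != j by apply: contraNneq ab => h; rewrite ai bj h.
    have [i0|i0] := eqVneq i ord0.
      exists [set ord0; j]; first by apply/imsetP; exists j => //; rewrite !inE -i0 eq_sym.
      by rewrite imsetU1 imset_set1 ee ai bj i0.
    have [j0|j0] := eqVneq j ord0.
      exists [set ord0; i]; first by apply/imsetP; exists i => //; rewrite !inE.
      by rewrite imsetU1 imset_set1 ee ai bj j0 setUC.
    exfalso; move: eE; rewrite ee ai bj !ffunE.
    case: i i0 ij {ai} => [[|[|[|[|i]]]] //= Hi] _;
    case: j j0 {bj} => [[|[|[|[|j]]]] //= Hj] _ //= _; apply/negP => //;
    by rewrite setUC.
  move=> [d /imsetP[i]]; rewrite !inE => i0 -> ->; split; last first.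
    by apply/subsetP => v /imsetP[k _ ->]; exact: imset_f.
  rewrite imsetU1 imset_set1 !ffunE /=.
  by case: i i0 => [[|[|[|[|i]]]] //= Hi].
apply/negP => /existsP[f /andP[/injectiveP finj /eqP /setP ind]].
pose o k (H : k < 4) := Ordinal H.
pose i1 := o 1 isT; pose i2 := o 2 isT; pose i3 := o 3 isT.
have im2 i j : [set f i; f j] = f @: [set i; j] by rewrite imsetU1 imset_set1.
have edge i : i != ord0 -> [set f ord0; f i] \in E.
  move=> i0; have := ind [set f ord0; f i]; rewrite inE.
  rewrite im2 => h.
  suff : [set ord0; i] \in claw by move=> /(imset_f (fun e : {set 'I_4} => f @: e)); rewrite -h => /andP[].
  by apply/imsetP; exists i => //; rewrite !inE.
have nonedge i j : i != ord0 -> j != ord0 -> [set f i; f j] \notin E.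
  move=> i0 j0; apply/negP => h; have := ind [set f i; f j]; rewrite inE h /=.
  rewrite im2 imsetS ?subsetT // => /esym/imsetP[d /imsetP[k _ ->]].
  move=> /(imset_inj finj)/setP/(_ ord0); rewrite !inE eqxx /=.
  by rewrite !(eq_sym ord0) (negbTE i0) (negbTE j0).
apply: (noc (f ord0) (f i1) (f i2) (f i3)); rewrite ?edge ?nonedge //.
by rewrite (map_inj_uniq finj [:: ord0; i1; i2; i3]).
Qed.

(** For disjoint [S] and [U] the pairs inside [U] stay hidden: these are the ones whose joint law is
    studied. *)
Definition link_pairs S U : {set {set V}} :=
  [set e in pairs (S :|: U) | ~~ [disjoint e & S]].

Lemma link_pairsS S S' U U' : S \subset S' -> S :|: U \subset S' :|: U' ->
  link_pairs S U \subset link_pairs S' U'.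
Proof.
move=> SS UU; apply/subsetP => e; rewrite !inE => /andP[/andP[h ->] d].
rewrite (subset_trans h UU) /=; apply: contraNN d; exact: disjointWr.
Qed.

Lemma link_pairs_perm (sg : {perm V}) S U :
  link_pairs (sg @: S) (sg @: U) = [set sg @: (e : {set V}) | e in link_pairs S U].
Proof.
have fwd (tau : {perm V}) A B e : e \in link_pairs A B ->
    tau @: e \in link_pairs (tau @: A) (tau @: B).
  rewrite !inE -imsetU card_imset; last exact: perm_inj.
  move=> /andP[/andP[h ->]]; rewrite imsetS //= -!setI_eq0 -imsetI; last first.
    by move=> u v _ _; exact: perm_inj.
  by apply: contraNN; rewrite imset_eq0.
have K (A : {set V}) : (sg^-1)%g @: (sg @: A) = A.
  by rewrite -imset_comp -[RHS]imset_id; apply: eq_imset => v /=; rewrite permK.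
have K' (A : {set V}) : sg @: ((sg^-1)%g @: A) = A.
  by rewrite -imset_comp -[RHS]imset_id; apply: eq_imset => v /=; rewrite permKV.
apply/setP => e; apply/idP/imsetP => [h|[d h ->]]; last exact: fwd.
by exists ((sg^-1)%g @: e); rewrite ?K' //; have := fwd (sg^-1)%g _ _ _ h; rewrite !K.
Qed.

Lemma exists_perm_pair S S' e e' : #|S| = #|S'| ->
  e \in pairs (~: S) -> e' \in pairs (~: S') ->
  exists sg : {perm V}, sg @: S = S' /\ sg @: e = e'.
Proof.
move=> SS /pairsP[x [y [xS yS xy ->]]] /pairsP[x' [y' [xS' yS' xy' ->]]].
have un A (u v : V) : u \in ~: A -> v \in ~: A -> u != v -> uniq (u :: v :: enum A).
  by rewrite !inE /= !inE !mem_enum => /negbTE-> /negbTE-> uv; rewrite negb_or uv enum_uniq.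
have [|sg [sx sy sS]] := perm_extend (un _ _ _ xS yS xy) (un _ _ _ xS' yS' xy').
  by rewrite /= -!cardE SS.
exists sg; split; last by rewrite imsetU1 imset_set1 sx sy.
apply/setP => v; rewrite -(mem_enum (mem S')) -sS; apply/imsetP/mapP => -[u uS ->].
  by exists u; rewrite ?mem_enum.
by exists u => //; rewrite mem_enum in uS.
Qed.

Lemma card_pairs S : #|pairs S| = 'C(#|S|, 2).
Proof. exact: cards_draws. Qed.

End ClawFree.

(** * The entropy of a window *)

Section FiniteUpperBound.
Import mathcomp.boot.fintype mathcomp.boot.finset.
Local Open Scope ring_scope.
Local Open Scope set_scope.
Variables (R : realType) (V : finType) (Om : {set {set {set V}}}) (m : nat).
Implicit Types (S U e : {set V}) (w : {set {set V}}).
Hypothesis Om_edges : forall w e, w \in Om -> e \in w -> #|e| = 2%N.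
Hypothesis Om_card : forall w, w \in Om -> #|w| = m.
Hypothesis Om_perm : forall (sg : {perm V}) w, w \in Om ->
  [set sg @: (e : {set V}) | e in w] \in Om.
Hypothesis Om_claw : forall w c x y z, w \in Om -> uniq [:: c; x; y; z] ->
  [set c; x] \in w -> [set c; y] \in w -> [set c; z] \in w ->
  [set x; y] \notin w -> [set x; z] \notin w -> [set y; z] \notin w -> False.

Local Notation n := #|V|.
Local Notation N := (#|Om|%:R : R).
Local Notation H := (centropy R Om).
Local Notation pr := (cprob R Om).

Lemma pairentropy_perm S S' e e' : #|S| = #|S'| ->
  e \in pairs (~: S) -> e' \in pairs (~: S') ->
  H (link_pairs S e) e = H (link_pairs S' e') e'.
Proof.
move=> SS eS eS'; have [sg [<- <-]] := exists_perm_pair SS eS eS'.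
rewrite link_pairs_perm; apply/esym.
apply: (@centropy_relabel R _ Om (fun e : {set V} => sg @: e)) => [|w]; last exact: Om_perm.
by apply: imset_inj; exact: perm_inj.
Qed.

Lemma card_edge_const e e' : e \in pairs setT -> e' \in pairs setT ->
  #|[set w in Om | e \in w]| = #|[set w in Om | e' \in w]|.
Proof.
rewrite -setC0 => he he'.
have [sg [_ <-]] := @exists_perm_pair V set0 set0 _ _ erefl he he'.
apply/esym; apply: (@card_mem_relabel _ Om (fun e : {set V} => sg @: e)) => [|w]; last exact: Om_perm.
by apply: imset_inj; exact: perm_inj.
Qed.

(** By symmetry all pairs are edges equally often, so counting edges twice gives each the mean
    probability [m / 'C(n, 2)], whatever [A] is. *)
Lemma sum_cprob_pair A e : e \in pairs setT ->
  (\sum_(w in Om) pr A e w) * 'C(n, 2)%:R = N * m%:R.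
Proof.
move=> eT; rewrite sum_cprob -!natrM; congr (_%:R).
rewrite -[n]cardsT -card_pairs mulnC -sum_nat_const.
rewrite (eq_bigr (fun e' => #|[set w in Om | e' \in w]|)); last first.
  by move=> e' he'; exact: card_edge_const.
rewrite -sum_nat_const (eq_bigr (fun w : {set {set V}} => #|w|)); last first.
  by move=> w /Om_card.
under eq_bigr do rewrite -sum1dep_card.
under [RHS]eq_bigr do rewrite -sum1_card.
rewrite (exchange_big_dep (mem Om)) /=; last by move=> e' w _ /andP[].
apply: eq_bigr => w wO; apply: eq_bigl => e'.
rewrite wO /= inE subsetT /=; case: (boolP (e' \in w)) => h; rewrite ?andbF ?andbT //.
by apply/eqP; exact: Om_edges h.
Qed.

(** Representatives, nested in [k] and disjoint from [e0], on which the entropy $a_k$ is read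
    off. *)
Definition ref_seq e0 k : {set V} := [set x in take k (enum (~: e0))].

Lemma card_ref_seq e0 k : (k <= #|~: e0|)%N -> #|ref_seq e0 k| = k.
Proof.
move=> h; rewrite cardsE; have /card_uniqP -> := take_uniq k (enum_uniq (~: e0)).
by rewrite size_take_min -cardE; apply/minn_idPl.
Qed.

Lemma ref_seq_disjoint e0 k : e0 \in pairs setT -> e0 \in pairs (~: ref_seq e0 k).
Proof.
rewrite !inE => /andP[_ ->]; rewrite andbT; apply/subsetP => x xe; rewrite !inE.
by apply: contraTN xe => /mem_take; rewrite mem_enum inE.
Qed.

Lemma ref_seqS e0 j k : (j <= k)%N -> ref_seq e0 j \subset ref_seq e0 k.
Proof.
move=> jk; apply/subsetP => x; rewrite !inE => h.
by move: h; rewrite -(take_takel _ jk); exact: mem_take.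
Qed.

(** This is $a_k$ scaled by [#|Om|]; by [pairentropyE] any [k]-set [S] and any pair outside [S] give
    the same value. *)
Definition pairentropy e0 k : R := H (link_pairs (ref_seq e0 k) e0) e0.

Lemma pairentropyE e0 S e k : e0 \in pairs setT -> #|S| = k ->
  e \in pairs (~: S) -> H (link_pairs S e) e = pairentropy e0 k.
Proof.
move=> e0T Sk eS; apply: pairentropy_perm => //; last exact: ref_seq_disjoint.
rewrite card_ref_seq // -Sk.
have := subset_leq_card (_ : S \subset ~: e).
move=> /(_ _); move: eS e0T; rewrite !inE => /andP[eS /eqP e2] /andP[_ /eqP e02].
rewrite -subsetC eS => /(_ isT) => h; apply: leq_trans h _.
by rewrite -(leq_add2l #|e|) cardsC e2 -e02 cardsC.
Qed.

Lemma pairentropy_antitone e0 j k : (j <= k)%N -> pairentropy e0 k <= pairentropy e0 j.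
Proof.
move=> jk; apply: centropyS; apply: link_pairsS; first exact: ref_seqS.
by rewrite setSU // ref_seqS.
Qed.

(** Reveal first the at most [k * n] pairs meeting [S], at a cost of at most [ln 2] each. Every
    other pair [e] is then conditioned on at least [link_pairs S e], so it costs at most $a_k$. *)
Lemma entropy_le_pairentropy e0 k : e0 \in pairs setT -> (k <= #|~: e0|)%N ->
  N * ln N <= N * (k * n)%:R * ln 2 + 'C(n, 2)%:R * pairentropy e0 k.
Proof.
move=> e0T kn; set S := ref_seq e0 k; have cS : #|S| = k := card_ref_seq kn.
pose T1 := link_pairs S [set: V].
have T1E : T1 \subset pairs setT.
  by apply/subsetP => e; rewrite !inE subsetT => /andP[/andP[_ ->]].
have TE : T1 :|: pairs (~: S) = pairs setT.
  apply/setP => e; rewrite !inE !subsetT setUT subsetT /=.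
  by rewrite disjoints_subset; case: (e \subset _); case: (#|e| == 2%N).
have lf0 : log_fiber R Om set0 = N * ln N.
  rewrite /log_fiber (eq_bigr (fun=> ln N)); first by rewrite sumr_const mulr_natl.
  by move=> w _; congr (ln _%:R); apply: eq_card => v; rewrite !inE !setI0 eqxx andbT.
have lfT : log_fiber R Om (pairs setT) = 0.
  rewrite /log_fiber big1 // => w wO; rewrite (_ : fiber _ _ _ = [set w]) ?cards1 ?ln1 //.
  have sub v : v \in Om -> v :&: pairs setT = v.
    move=> vO; apply/setIidPl/subsetP => e ev; rewrite inE subsetT /=.
    by rewrite (Om_edges vO ev).
  apply/setP => v; rewrite !inE (sub w wO); apply/andP/eqP => [[vO]|->].
    by rewrite sub // => /eqP.
  by rewrite sub.
have b1 : log_fiber R Om set0 - log_fiber R Om T1 <= N * (k * n)%:R * ln 2.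
  rewrite -[T1]set0U; apply: le_trans (_ : \sum_(e in T1) N * ln 2 <= _).
    by apply: log_fiber_drop_le => e D' _ _; exact: centropy_le.
  rewrite sumr_const -[leLHS]mulr_natr mulrAC ler_wpM2r ?ln_ge0 ?ler1n //.
  rewrite ler_wpM2l // ler_nat.
  have sub : T1 \subset [set [set p.1; p.2] | p in setX S setT].
    apply/subsetP => e; rewrite inE => /andP[/pairsP[x [y [_ _ _ ->]]]].
    rewrite -setI_eq0 => /set0Pn[u]; rewrite !inE => /andP[/orP[]/eqP-> uS].
      by apply/imsetP; exists (x, y) => //; rewrite !inE uS.
    by apply/imsetP; exists (y, x); rewrite ?inE ?uS //= setUC.
  apply: leq_trans (subset_leq_card sub) _; apply: leq_trans (leq_imset_card _ _) _.
  by rewrite cardsX cardsT cS.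
have b2 : log_fiber R Om T1 - log_fiber R Om (T1 :|: pairs (~: S)) <=
    'C(n, 2)%:R * pairentropy e0 k.
  apply: le_trans (_ : \sum_(e in pairs (~: S)) pairentropy e0 k <= _).
    apply: log_fiber_drop_le => e D' eS _; rewrite -(pairentropyE e0T cS eS).
    apply: centropyS; apply: subset_trans (subsetUl _ _).
    by apply: link_pairsS => //; rewrite setUS.
  rewrite sumr_const -[leLHS]mulr_natl ler_wpM2r ?centropy_ge0 // ler_nat.
  by rewrite card_pairs leq_bin2l // max_card.
move: b1 b2; rewrite TE lf0 lfT; lra.
Qed.

Lemma card_set6 (T : finType) (x1 x2 x3 x4 x5 x6 : T) :
  (#|[set x1; x2; x3; x4; x5; x6]| <= 6)%N.
Proof.
apply: leq_trans (card_size [:: x1; x2; x3; x4; x5; x6]).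
by apply: subset_leq_card; apply/subsetP => x; rewrite !inE -!orbA.
Qed.

Section Window.
Variables (e0 S U : {set V}) (k K : nat) (eps : R).
Hypotheses (e0T : e0 \in pairs setT) (cS : #|S| = k) (cU : #|U| = K) (SU : [disjoint S & U]).
Hypothesis drop_small : pairentropy e0 k - pairentropy e0 (k + K) <= eps.

Local Notation F := (link_pairs S U).

Lemma window_subC e : e \in pairs U -> e \in pairs (~: S).
Proof.
rewrite !inE => /andP[eU ->]; rewrite andbT; apply: subset_trans eU _.
by rewrite -disjoints_subset disjoint_sym.
Qed.

Lemma window_upper e : e \in pairs U -> H F e <= pairentropy e0 k.
Proof.
move=> eU; rewrite -(pairentropyE e0T cS (window_subC eU)); apply: centropyS.
by apply: link_pairsS => //; rewrite setUS //; move: eU; rewrite inE => /andP[].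
Qed.

(* Conditioning on [X] reveals no more than adding to [S] the vertices of [U]
   outside [e]. *)
Lemma window_lower e (X : {set {set V}}) : e \in pairs U -> X \subset pairs U :\ e ->
  pairentropy e0 (k + K) <= H (F :|: X) e.
Proof.
move=> eU XU; have := eU; rewrite inE => /andP[eU' /eqP e2].
have eS := window_subC eU; have := eS; rewrite inE => /andP[eS' _].
have cSU : #|S :|: (U :\: e)| = (k + (K - 2))%N.
  rewrite cardsU cS cardsD cU (setIidPr eU') e2 (_ : S :&: _ = set0) ?cards0 ?subn0 //.
  by apply/eqP; rewrite setI_eq0; apply: disjointWr SU; exact: subsetDl.
(* Only [K - 2] vertices join [S], as [e] uses two of [U]; monotonicity replaces this by [K]. *)
apply: le_trans (pairentropy_antitone e0 (_ : (k + (K - 2) <= k + K)%N)) _; first lia.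
rewrite -(pairentropyE (e := e) e0T cSU); last first.
  rewrite inE e2 eqxx andbT setCU subsetI eS' /=; apply/subsetP => x xe.
  by rewrite !inE xe.
apply: centropyS; apply/subsetP => d; rewrite in_setU => /orP[].
  rewrite !inE => /andP[/andP[dSU ->] dS]; apply/andP; split; first rewrite andbT.
    apply: subset_trans dSU _; rewrite -setUA setUS //; apply/subsetP => x xU.
    by rewrite !inE xU andbT orNb.
  by apply: contraNN dS; apply: disjointWr; exact: subsetUl.
move=> /(subsetP XU); rewrite !inE => /andP[de /andP[dU d2]]; rewrite d2 andbT.
apply/andP; split.
  apply: subset_trans dU _; rewrite -setUA; apply/subsetP => x xU.
  by rewrite !inE xU andbT orNb orbT.
(* Two distinct pairs: [d] has a vertex outside [e], so it meets the enlarged [S]. *)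
have [x xd xe] : exists2 x, x \in d & x \notin e.
  apply/subsetPn; apply: contraNN de => sub.
  by rewrite eqEcard sub e2 (eqP d2).
rewrite -setI_eq0; apply/set0Pn; exists x.
by rewrite !inE xd xe (subsetP dU) // orbT.
Qed.

(** This is [missing_outcome] for the six pairs of a potential claw, with the claw itself as
    impossible outcome. Each pair has entropy at most $a_k$ alone and at least $a_{k+K}$ given the
    others, so the divergence is at most six drops. *)
Lemma claw_weight_le c x y z : c \in U -> x \in U -> y \in U -> z \in U ->
  uniq [:: c; x; y; z] ->
  \sum_(w in Om) \prod_(e in [set [set c; x]; [set c; y]; [set c; z]; [set x; y]; [set x; z]; [set y; z]])
     outcome_prob R Om F e w [set [set c; x]; [set c; y]; [set c; z]] <= 6 * eps.
Proof.
move=> cU' xU yU zU un; set D := [set _; _; _; _; _; _]; set J := [set _; _; _].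
have := un; rewrite /= !inE !negb_or => /and4P[/and3P[cx cy cz] /andP[xy xz] yz _].
have DU : D \subset pairs U.
  by apply/subsetP => e; rewrite !inE -!orbA => /or4P[|||/or3P[]] /eqP->;
     rewrite subUset !sub1set ?cU' ?xU ?yU ?zU /= cards2 ?cx ?cy ?cz ?xy ?xz ?yz.
have cD : (#|D| <= 6)%N by exact: card_set6.
have JD : J \subset D by apply/subsetP => e; rewrite !inE -!orbA => /or3P[] ->; rewrite ?orbT.
have notJ (a b : V) : a != c -> b != c -> [set a; b] \notin J.
  move=> ac bc; apply/negP; rewrite !inE -!orbA => h.
  have : c \in [set a; b] by case/or3P: h => /eqP->; rewrite !inE eqxx.
  by rewrite !inE !(eq_sym c) (negbTE ac) (negbTE bc).
apply: le_trans (@missing_outcome R _ Om F D J JD _) _.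
  move=> w wO; apply/eqP => wJ.
  have inw e : e \in J -> e \in w by rewrite -wJ inE => /andP[].
  have ninw e : e \in D -> e \notin J -> e \notin w.
    by move=> eD; apply: contraNN => ew; rewrite -wJ inE ew.
  apply: (Om_claw wO un); try (apply: inw; by rewrite !inE eqxx ?orbT);
  (apply: ninw; [by rewrite !inE eqxx ?orbT|by apply: notJ; rewrite eq_sym]).
have h1 : \sum_(e in D) H F e <= \sum_(e in D) pairentropy e0 k.
  by apply: ler_sum => e /(subsetP DU) eU; exact: window_upper.
have h2 : \sum_(e in D) pairentropy e0 (k + K) <= log_fiber R Om F - log_fiber R Om (F :|: D).
  apply: log_fiber_drop_ge => e D' eD D'D; apply: window_lower; first exact: (subsetP DU).
  by apply: subset_trans D'D _; exact: setSD.
have h3 : \sum_(e in D) (pairentropy e0 k - pairentropy e0 (k + K)) <= 6 * eps.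
  have d0 : 0 <= pairentropy e0 k - pairentropy e0 (k + K).
    by rewrite subr_ge0; apply: pairentropy_antitone; exact: leq_addr.
  rewrite sumr_const -[leLHS]mulr_natl; apply: ler_pM => //.
  by rewrite ler_nat.
rewrite big_split /= sumrN in h3.
by apply: le_trans h3; apply: lerB.
Qed.

Variable s : nat.
Hypothesis s2 : (2 <= s)%N.
Local Notation eta := (((s%:R : R) ^+ 2)^-1).

Let eta_bounds : 0 < eta <= 1 / 4.
Proof.
have s2R : 2 <= (s%:R : R) by rewrite ler_nat.
rewrite invr_gt0 exprn_gt0 ?div1r ?lef_pV2 ?posrE ?exprn_gt0 //=; try lra.
nra.
Qed.

Definition nonwhite_at w e := eta <= pr F e w.
Definition nonblack_at w e := pr F e w <= 1 - eta.

Definition claw_at w c x y z := [&& uniq [:: c; x; y; z],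
  nonwhite_at w [set c; x], nonwhite_at w [set c; y], nonwhite_at w [set c; z],
  nonblack_at w [set x; y], nonblack_at w [set x; z] & nonblack_at w [set y; z]].

(** Markov's inequality: where [claw_at] holds, each of the at most six factors in [claw_weight_le]
    is at least [eta]. *)
Lemma claw_at_rare c x y z : c \in U -> x \in U -> y \in U -> z \in U ->
  \sum_(w in Om) ((claw_at w c x y z)%:R : R) <= 6 * eps / eta ^+ 6.
Proof.
have /andP[eta0 eta1] := eta_bounds.
move=> cU' xU yU zU; rewrite ler_pdivlMr ?exprn_gt0 // mulr_suml.
case: (boolP (uniq [:: c; x; y; z])) => un; last first.
  rewrite big1 => [|w _]; last by rewrite /claw_at (negbTE un) mul0r.
  rewrite mulr_ge0 //; apply: le_trans drop_small.
  by rewrite subr_ge0; apply: pairentropy_antitone; exact: leq_addr.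
apply: le_trans (claw_weight_le cU' xU yU zU un); apply: ler_sum => w wO.
set D := [set _; _; _; _; _; _]; set J := [set _; _; _].
have prod0 : 0 <= \prod_(e in D) outcome_prob R Om F e w J.
  by apply: prodr_ge0 => e _; exact: outcome_prob_ge0.
case: (boolP (claw_at w c x y z)) => [|_]; last by rewrite mul0r.
rewrite /claw_at un mul1r => /and5P[_ wx wy wz /and3P[bxy bxz byz]].
have cD : (#|D| <= 6)%N by exact: card_set6.
apply: (@le_trans _ _ (eta ^+ #|D|)); first by apply: ler_wiXn2l => //; lra.
rewrite -prodr_const; apply: ler_prod => e eD; rewrite ltW //=.
have := un; rewrite /= !inE !negb_or => /and4P[/and3P[cx cy cz] _ _ _].
have notJ (a b : V) : a != c -> b != c -> [set a; b] \in J = false.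
  move=> ac bc; apply/negP; rewrite !inE -!orbA => h.
  have : c \in [set a; b] by case/or3P: h => /eqP->; rewrite !inE eqxx.
  by rewrite !inE !(eq_sym c) (negbTE ac) (negbTE bc).
have [J1 J2 J3] : [/\ [set c; x] \in J, [set c; y] \in J & [set c; z] \in J].
  by split; rewrite !inE eqxx ?orbT.
have [x' y' z'] : [/\ x != c, y != c & z != c] by split; rewrite eq_sym.
have {}eD : [|| e == [set c; x], e == [set c; y], e == [set c; z],
  e == [set x; y], e == [set x; z] | e == [set y; z]].
  by move: eD; rewrite !inE -!orbA.
rewrite /outcome_prob; case/or4P: eD => [/eqP->|/eqP->|/eqP->|].
- by rewrite J1.
- by rewrite J2.
- by rewrite J3.
move: bxy bxz byz; rewrite /nonblack_at => bxy bxz byz.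
case/or3P => /eqP->; rewrite notJ //; lra.
Qed.

Variables (la : R).
Hypothesis la0 : 0 < la.
Local Notation b := (ln la).
Local Notation g := (ln (1 + la)).
Hypothesis gb : 0 <= g + b.

Let ln_la_le : b <= g.
Proof. by rewrite ler_ln ?posrE ?addr_gt0 // lerDr. Qed.

Definition bad_at w := [exists c in U, exists x in U, exists y in U, exists z in U, claw_at w c x y z].

(** Union bound over the [K ^ 4] quadruples of vertices of [U]. *)
Lemma bad_rare : \sum_(w in Om) ((bad_at w)%:R : R) <= K%:R ^+ 4 * (6 * eps / eta ^+ 6).
Proof.
apply: (@le_trans _ _ (\sum_(w in Om) \sum_(c in U) \sum_(x in U) \sum_(y in U) \sum_(z in U)
    ((claw_at w c x y z)%:R : R))).
  apply: ler_sum => w _; have [|_] := boolP (bad_at w); last by do ! (apply: sumr_ge0 => ? _).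
  case/exists_inP => c cU' /exists_inP[x xU] /exists_inP[y yU] /exists_inP[z zU] cl.
  rewrite (bigD1 c) //= (bigD1 x) //= (bigD1 y) //= (bigD1 z) //= cl.
  by rewrite -!addrA lerDl !addr_ge0 //; do ! (apply: sumr_ge0 => ? _).
rewrite exchange_big /=; under eq_bigr do rewrite exchange_big /=.
under eq_bigr => c _ do under eq_bigr => x _ do rewrite exchange_big /=.
under eq_bigr => c _ do under eq_bigr => x _ do under eq_bigr => y _ do rewrite exchange_big /=.
apply: (@le_trans _ _ (\sum_(c in U) \sum_(x in U) \sum_(y in U) \sum_(z in U) (6 * eps / eta ^+ 6))).
  by do 4 (apply: ler_sum => ? ?); exact: claw_at_rare.
rewrite !sumr_const cU -!mulrnA -[leLHS]mulr_natl !natrM le_eqVlt; apply/orP; left.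
by apply/eqP; ring.
Qed.

(** Grey pairs fall under [nat_entropy_tilted]. White and black ones have entropy at most [4 / s] by
    [nat_entropy_small], and rounding their probability to 0 or 1 costs at most [eta] times the
    absolute value of [b]. *)
Lemma pair_free_energy w e :
  nat_entropy (pr F e w) + pr F e w * b <=
   (grey (nonwhite_at w) (nonblack_at w) e)%:R * g +
   (black (nonblack_at w) e)%:R * b + (4 / s%:R + `|b| * eta).
Proof.
have /andP[eta0 eta1] := eta_bounds.
have s0 : 0 < (s%:R : R) by rewrite ltr0n; lia.
have hp := cprob_bounds R Om F e w; have /andP[p0 p1] := hp.
have a0 : 0 <= 4 / (s%:R : R) by rewrite divr_ge0 // ltW.
have a1 : 0 <= `|b| * eta by rewrite mulr_ge0 // ltW.
have bl : b <= `|b| := ler_norm b.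
have bl' : - b <= `|b| by rewrite -normrN ler_norm.
have tilt := nat_entropy_tilted hp la0.
rewrite /grey /black; case: (boolP (nonwhite_at w e)) => hw;
  case: (boolP (nonblack_at w e)) => hb /=.
- by rewrite mul1r mul0r; lra.
- move: hb; rewrite /nonblack_at -ltNge => hb.
  have := @nat_entropy_small R (1 - pr F e w) s s2; rewrite nat_entropyN => /(_ _).
  rewrite mul0r mul1r add0r => h.
  have {}h := h ltac:(lra).
  have : pr F e w * b <= b + `|b| * eta by nra.
  lra.
- move: hw; rewrite /nonwhite_at -ltNge => hw.
  have h := @nat_entropy_small R (pr F e w) s s2 ltac:(lra).
  have : pr F e w * b <= `|b| * eta by nra.
  by rewrite !mul0r; lra.
- by move: hw hb; rewrite /nonwhite_at /nonblack_at -!ltNge; lra.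
Qed.

Lemma good_free_energy w : ~~ bad_at w ->
  \sum_(e in pairs U) (nat_entropy (pr F e w) + pr F e w * b) <=
  (g - b) * K%:R + 'C(K, 2)%:R * ((g + b) / 2 + (4 / s%:R + `|b| * eta)).
Proof.
set err := 4 / s%:R + _; move=> good.
apply: (@le_trans _ _ (\sum_(e in pairs U)
    ((grey (nonwhite_at w) (nonblack_at w) e)%:R * g +
     (black (nonblack_at w) e)%:R * b + err))).
  by apply: ler_sum => e _; exact: pair_free_energy.
clearbody err.
rewrite !big_split /= -!mulr_suml sumr_const card_pairs cU -[X in _ + X <= _]mulr_natl.
have /andP[eta0 eta1] := eta_bounds.
have col e : nonwhite_at w e || nonblack_at w e.
  by rewrite /nonwhite_at /nonblack_at; case: leP => //= h; lra.
have := grey_le_black col (A := U).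
move=> /(_ _) h; have {}h := h _.
have {}h : (\sum_(e in pairs U) grey (nonwhite_at w) (nonblack_at w) e <=
   \sum_(e in pairs U) black (nonblack_at w) e + 2 * #|U|)%N.
  apply: h => c x y z cU' xU yU zU un h1 h2 h3 h4 h5 h6; apply: (negP good).
  apply/exists_inP; exists c => //; apply/exists_inP; exists x => //.
  apply/exists_inP; exists y => //; apply/exists_inP; exists z => //.
  by rewrite /claw_at un h1 h2 h3 h4 h5 h6.
have tot : (\sum_(e in pairs U) grey (nonwhite_at w) (nonblack_at w) e +
   \sum_(e in pairs U) black (nonblack_at w) e <= 'C(K, 2))%N.
  rewrite -cU -card_pairs -sum1_card -big_split /=; apply: leq_sum => e _.
  by rewrite /grey /black; case: (nonblack_at w e); case: (nonwhite_at w e).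
move: h tot; rewrite -!(ler_nat R) !natrD !natr_sum cU.
move: (\sum_(e in pairs U) _) (\sum_(e in pairs U) _) => B G h tot.
have bg := ln_la_le.
(* Half the sum of [h1] and [h2] is the claim; [K%:R + (K%:R + 0)] is the bound [2 * K] on the
   surplus of grey pairs. *)
have h1 : 0 <= (g - b) * (B + (K%:R + (K%:R + 0)) - G) by rewrite mulr_ge0 // subr_ge0.
have h2 : 0 <= (g + b) * ('C(K, 2)%:R - (G + B)) by rewrite mulr_ge0 // subr_ge0.
nra.
Qed.

(** Both sides bound the sum, over [w] and the pairs of [U], of entropy plus [b] times edge
    probability. The lower estimate is [window_lower] with nothing added and [sum_cprob_pair]; the
    upper one is [good_free_energy], plus [g] per pair for the rare bad [w]. *)
Lemma window_bound : (2 <= n)%N ->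
  'C(K, 2)%:R * (pairentropy e0 (k + K) + b * N * m%:R / 'C(n, 2)%:R) <=
  N * ((g - b) * K%:R + 'C(K, 2)%:R * ((g + b) / 2 + (4 / s%:R + `|b| * eta))) +
  'C(K, 2)%:R * g * (K%:R ^+ 4 * (6 * eps / eta ^+ 6)).
Proof.
move=> n2.
have C0 : 0 < 'C(n, 2)%:R :> R by rewrite ltr0n bin_gt0.
have g0 : 0 <= g by apply: ln_ge0; rewrite lerDl ltW.
have bg := ln_la_le.
set Q := (g - b) * K%:R + _.
have /andP[eta0 eta1] := eta_bounds.
have Q0 : 0 <= Q.
  have r1 : 0 <= 4 / (s%:R : R) by rewrite divr_ge0.
  have r2 : 0 <= `|b| * eta by rewrite mulr_ge0 // ltW.
  rewrite addr_ge0 // mulr_ge0 ?subr_ge0 //.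
  by rewrite !addr_ge0 // divr_ge0.
apply: (@le_trans _ _ (\sum_(w in Om) \sum_(e in pairs U) (nat_entropy (pr F e w) + pr F e w * b))).
  rewrite exchange_big /= -cU -card_pairs [leLHS]mulr_natl -[leLHS]sumr_const.
  apply: ler_sum => e eU; rewrite big_split /= lerD //.
    by rewrite cU; have := window_lower eU (sub0set _); rewrite setU0.
  have eT : e \in pairs setT by move: eU; rewrite !inE subsetT => /andP[_ ->].
  have C0n : 'C(n, 2)%:R != 0 :> R by rewrite gt_eqF.
  rewrite -mulr_suml; have /(canRL (mulfK C0n)) -> := sum_cprob_pair F eT.
  by rewrite le_eqVlt; apply/orP; left; apply/eqP; ring.
apply: (@le_trans _ _ (\sum_(w in Om) (Q + (bad_at w)%:R * ('C(K, 2)%:R * g)))).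
  apply: ler_sum => w wO; have [bad|good] := boolP (bad_at w); last first.
    by rewrite mul0r addr0; exact: good_free_energy.
  apply: (@le_trans _ _ ('C(K, 2)%:R * g)); last by rewrite mul1r lerDr.
  rewrite -cU -card_pairs mulr_natl -[leRHS]sumr_const; apply: ler_sum => e _.
  by apply: nat_entropy_tilted => //; exact: cprob_bounds.
rewrite big_split /= sumr_const -[Q *+ _]mulr_natl lerD2l -mulr_suml.
by rewrite mulrC ler_wpM2l ?mulr_ge0 //; exact: bad_rare.
Qed.

End Window.

End FiniteUpperBound.

(** * Choice of the window by pigeonhole *)

Section UpperBoundAveraged.
Import mathcomp.boot.fintype mathcomp.boot.finset.
Local Open Scope ring_scope.
Local Open Scope set_scope.
Variables (R : realType) (V : finType) (Om : {set {set {set V}}}) (m : nat).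
Implicit Types (e : {set V}) (w : {set {set V}}).
Hypothesis Om_edges : forall w e, w \in Om -> e \in w -> #|e| = 2%N.
Hypothesis Om_card : forall w, w \in Om -> #|w| = m.
Hypothesis Om_perm : forall (sg : {perm V}) w, w \in Om ->
  [set sg @: (e : {set V}) | e in w] \in Om.
Hypothesis Om_claw : forall w c x y z, w \in Om -> uniq [:: c; x; y; z] ->
  [set c; x] \in w -> [set c; y] \in w -> [set c; z] \in w ->
  [set x; y] \notin w -> [set x; z] \notin w -> [set y; z] \notin w -> False.

Local Notation n := #|V|.
Local Notation N := (#|Om|%:R : R).

(** The first [L] drops telescope to at most [a 0], so one is at most the average. *)
Lemma small_drop (a : nat -> R) (L : nat) : (0 < L)%N -> (forall j, 0 <= a j) ->
  exists2 j, (j < L)%N & a j - a j.+1 <= a 0%N / L%:R.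
Proof.
move=> L0 a0; have L0R : 0 < (L%:R : R) by rewrite ltr0n.
have [/existsP[j hj]|] := boolP [exists j : 'I_L, a j - a j.+1 <= a 0%N / L%:R].
  by exists j.
rewrite negb_exists => /forallP h; exfalso.
have : \sum_(j < L) (a 0%N / L%:R) < \sum_(j < L) (a j - a j.+1).
  apply: ltr_sum => [|j _]; last by rewrite ltNge h.
  by apply/hasP; exists (Ordinal L0) => //; rewrite mem_index_enum.
rewrite sumr_const card_ord -[X in X < _]mulr_natr divfK ?gt_eqF //.
rewrite -(big_mkord xpredT (fun j => a j - a j.+1)).
under eq_bigr do rewrite -opprB.
rewrite sumrN telescope_sumr // opprB ltrBrDr gtrDl ltNge; apply/negP/negPn; exact: a0.
Qed.

(** Used with [M = #|Om|], [C] and [CK] the numbers of pairs on [n] and on [K] vertices,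
    [E = eta ^+ 6], and [a], [a'] the scaled $a_k$, $a_{k+K}$. The bound passes from [lM] to [a],
    then to [a'], then to the template estimate. *)
Lemma averaging_arith (M C CK L E l2 a a' b g err lM kn k2n m' K x : R) :
  0 < M -> 0 < C -> 0 < CK -> 0 < L -> 0 < E -> 0 <= l2 ->
  M * lM <= M * kn * l2 + C * a ->
  CK * (a' + b * M * m' / C) <= M * ((g - b) * K + CK * ((g + b) / 2 + err)) +
    CK * g * (K ^+ 4 * (6 * (M * l2 / L) / E)) ->
  a - a' <= M * l2 / L -> kn <= k2n * x ->
  lM / C <= (g + b) / 2 - b * (m' / C) +
    ((g - b) * (K / CK) + err + (1 + g * (K ^+ 4 * (6 / E))) * (l2 / L)) +
    k2n * l2 * (x / C).
Proof.
move=> M0 C0 CK0 L0 E0 l20 h1 h2 h3 h4.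
have u1 : lM / C <= kn * l2 / C + a / M.
  rewrite -(ler_pM2l (mulr_gt0 C0 M0)) [leLHS](_ : _ = M * lM).
    apply: le_trans h1 _; rewrite le_eqVlt; apply/orP; left; apply/eqP.
    by field; rewrite !gt_eqF.
  by field; rewrite gt_eqF.
have u2 : a / M <= a' / M + l2 / L.
  rewrite -(ler_pM2l M0) mulrDr !(mulrC M) !mulfVK ?gt_eqF //.
  by rewrite -lerBlDl; apply: le_trans h3 _; rewrite mulrC mulrA.
have u3 : a' / M <= - (b * (m' / C)) + (g - b) * (K / CK) + ((g + b) / 2 + err) +
    g * (K ^+ 4 * (6 / E)) * (l2 / L).
  rewrite -(ler_pM2l (mulr_gt0 CK0 M0)) [leLHS](_ : _ = CK * a').
    move: h2; rewrite mulrDr -lerBrDr => h2; apply: le_trans h2 _.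
    rewrite le_eqVlt; apply/orP; left; apply/eqP.
    by field; rewrite !gt_eqF.
  by field; rewrite gt_eqF.
have u4 : kn * l2 / C <= k2n * l2 * (x / C).
  rewrite mulrA [X in _ <= X / C]mulrAC; apply: ler_wpM2r; first by rewrite invr_ge0 ltW.
  exact: ler_wpM2r.
lra.
Qed.

Lemma finite_upper (K L s : nat) (la : R) :
  (0 < #|Om|)%N -> (2 <= K)%N -> (0 < L)%N -> (2 <= s)%N -> 0 < la ->
  0 <= ln (1 + la) + ln la -> (L.+1 * K + 2 <= n)%N ->
  ln N / 'C(n, 2)%:R <=
    (ln (1 + la) + ln la) / 2 - ln la * (m%:R / 'C(n, 2)%:R) +
    ((ln (1 + la) - ln la) * (K%:R / 'C(K, 2)%:R) +
     (4 / s%:R + `|ln la| * (s%:R ^+ 2)^-1) +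
     (1 + ln (1 + la) * (K%:R ^+ 4 * (6 / ((s%:R ^+ 2)^-1) ^+ 6))) * (ln 2 / L%:R)) +
    (L * K)%:R * ln 2 * (n%:R / 'C(n, 2)%:R).
Proof.
move=> N0 K2 L0 s2 la0 gb nK.
have n2 : (2 <= n)%N by lia.
have N0R : 0 < N by rewrite ltr0n.
have Cn : 0 < ('C(n, 2)%:R : R) by rewrite ltr0n bin_gt0.
have CK : 0 < ('C(K, 2)%:R : R) by rewrite ltr0n bin_gt0.
have [e0 e0T] : exists e0, e0 \in pairs [set: V].
  by apply/set0Pn; rewrite -card_gt0 card_pairs cardsT bin_gt0.
have ce0 : #|~: e0| = (n - 2)%N.
  by move: e0T; rewrite inE => /andP[_ /eqP e2]; rewrite -e2 -(cardsC e0) addKn.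
(* Sampling along multiples of [K] makes one step of the sequence a whole window, and [k = j * K]
   stays below [L * K] whatever [n] is. *)
have [j jL hj] := @small_drop (fun j => pairentropy R Om e0 (j * K)) L L0
  (fun j => @centropy_ge0 R _ Om _ _).
set k := (j * K)%N in hj *.
have kL : (k <= L * K)%N by rewrite /k leq_mul2r ltnW ?orbT.
have a0 : pairentropy R Om e0 (0 * K) / L%:R <= N * ln 2 / L%:R.
  by rewrite ler_wpM2r ?invr_ge0 //; exact: centropy_le.
have kn : (k <= #|~: e0|)%N by rewrite ce0; lia.
have cS := card_ref_seq kn; set S := ref_seq e0 k in cS.
have [U /andP[US /eqP cU]] : exists U : {set V}, (U \subset ~: S) && (#|U| == K).
  have : (0 < #|[set U : {set V} | U \subset ~: S & #|U| == K]|)%N.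
    by rewrite cards_draws bin_gt0 -(leq_add2l #|S|) cardsC cS; lia.
  by rewrite card_gt0 => /set0Pn[U]; rewrite inE; exists U.
have SU : [disjoint S & U] by rewrite disjoint_sym disjoints_subset.
have drop : pairentropy R Om e0 k - pairentropy R Om e0 (k + K) <= N * ln 2 / L%:R.
  by apply: le_trans a0; apply: le_trans hj; rewrite mulSn addnC.
have := window_bound (R := R) Om_edges Om_card Om_perm Om_claw e0T cS cU SU drop s2 la0 gb n2.
have := entropy_le_pairentropy R Om_edges Om_perm e0T kn.
have eta6 : 0 < (((s%:R : R) ^+ 2)^-1) ^+ 6.
  by rewrite exprn_gt0 // invr_gt0 exprn_gt0 // ltr0n; exact: ltn_trans s2.
have h4 : (k * n)%:R <= (L * K)%:R * n%:R :> R by rewrite -natrM ler_nat leq_mul2r kL orbT.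
have LR : 0 < (L%:R : R) by rewrite ltr0n.
have l2 : 0 <= ln 2 :> R by rewrite ln_ge0 // ler1n.
move=> h1 h2; exact: (averaging_arith N0R Cn CK LR eta6 l2 h1 h2 drop h4).
Qed.

End UpperBoundAveraged.

(** * Lower bound *)

Section LowerBound.
Import mathcomp.boot.fintype mathcomp.boot.finset.
Local Open Scope ring_scope.
Local Open Scope set_scope.

(** Stirling's formula up to $O(\ln n)$, by induction from $1/(n+1) \le \ln(n+1) - \ln n \le 1/n$;
    the values 0 and 1 are checked apart. *)
Lemma ln_fact_bounds (R : realType) (n : nat) :
  (n%:R * ln n%:R - n%:R <= ln (n`!%:R : R)) &&
  (ln (n`!%:R : R) <= n%:R * ln n%:R - n%:R + ln n%:R + 1).
Proof.
elim: n => [|n /andP[lo hi]]; first by rewrite fact0 ln1 mul0r (ln0 (lexx 0)); lra.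
have [->|n0] := posnP n; first by rewrite factS fact0 muln1 ln1; lra.
have nR : 0 < (n%:R : R) by rewrite ltr0n.
have SR : 0 < (n.+1%:R : R) by rewrite ltr0n.
have Sn : (n.+1%:R : R) = n%:R + 1 by rewrite -natr1.
rewrite factS natrM lnM ?posrE ?ltr0n ?fact_gt0 //.
have d1 : ln n.+1%:R - ln n%:R <= (n%:R : R)^-1.
  rewrite -ln_div ?posrE //; apply: le_trans (ln_le_subr1 _) _; first by rewrite divr_gt0.
  by rewrite Sn le_eqVlt; apply/orP; left; apply/eqP; field; rewrite gt_eqF.
have d2 : ln n%:R - ln n.+1%:R <= - (n.+1%:R : R)^-1.
  rewrite -ln_div ?posrE //; apply: le_trans (ln_le_subr1 _) _; first by rewrite divr_gt0.
  by rewrite Sn le_eqVlt; apply/orP; left; apply/eqP; field; rewrite -Sn gt_eqF.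
move: d1; rewrite -(ler_pM2l nR) divff ?gt_eqF // => d1.
move: d2; rewrite -(ler_pM2l SR) mulrN divff ?gt_eqF // => d2.
rewrite Sn in d1 d2 *; nra.
Qed.

(** The linear terms of the factorial bounds cancel; the loss comes from [ln j + 1] and
    [ln (N - j) + 1] in the two upper bounds. *)
Lemma ln_bin_ge (R : realType) (N j : nat) : (0 < j < N)%N ->
  N%:R * nat_entropy (j%:R / N%:R : R) - 2 * ln N%:R - 2 <= ln 'C(N, j)%:R.
Proof.
move=> /andP[j0 jN].
have jR : 0 < (j%:R : R) by rewrite ltr0n.
have NR : 0 < (N%:R : R) by rewrite ltr0n; lia.
have kR : 0 < ((N - j)%:R : R) by rewrite ltr0n subn_gt0.
have E := @bin_fact N j (ltnW jN).
have : ln (N`!%:R : R) = ln 'C(N, j)%:R + (ln j`!%:R + ln (N - j)`!%:R).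
  by rewrite -E !natrM !lnM ?posrE ?mulr_gt0 ?ltr0n ?fact_gt0 ?bin_gt0 // ltnW.
have /andP[l1 _] := ln_fact_bounds R N.
have /andP[_ l2] := ln_fact_bounds R j.
have /andP[_ l3] := ln_fact_bounds R (N - j).
have m1 : ln (j%:R : R) <= ln N%:R by rewrite ler_ln ?posrE // ler_nat ltnW.
have m2 : ln ((N - j)%:R : R) <= ln N%:R by rewrite ler_ln ?posrE // ler_nat leq_subr.
rewrite /nat_entropy (_ : 1 - j%:R / N%:R = (N - j)%:R / N%:R :> R); last first.
  by rewrite natrB ?(ltnW jN) //; field; rewrite gt_eqF.
rewrite !ln_div ?posrE //.
set lN := ln N%:R in l1 m1 m2 *; set lj := ln j%:R in l2 m1 *.
set lk := ln (N - j)%:R in l3 m2 *.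
rewrite (_ : N%:R * _ = N%:R * lN - j%:R * lj - (N - j)%:R * lk); last first.
  by rewrite natrB ?(ltnW jN) //; field; rewrite gt_eqF.
have : (N%:R : R) = j%:R + (N - j)%:R by rewrite -natrD subnKC // (ltnW jN).
lra.
Qed.

(** Two disjoint cliques of order [s] have [s * s.-1] edges together, and any [j] of the [s * s]
    pairs between them may be added. Of three neighbours of a vertex, two lie in the same clique and
    are adjacent. *)
Lemma card_claw_free_ge (n s j : nat) : (s + s <= n)%N -> (j <= s * s)%N ->
  ('C(s * s, j) <= #|claw_free_graphs n (s * s.-1 + j)|)%N.
Proof.
move=> sn js.
pose X : {set 'I_n} := [set i : 'I_n | (i < s)%N].
pose Y : {set 'I_n} := [set i : 'I_n | (s <= i < s + s)%N].
have cI (a b : nat) : (a + b <= n)%N -> #|[set i : 'I_n | (a <= i < a + b)%N]| = b.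
  move=> ab; have inj : injective (fun i : 'I_b => widen_ord ab (rshift a i)).
    by move=> i i' /(congr1 val) /= /eqP; rewrite eqn_add2l => /eqP/val_inj.
  rewrite -[RHS]card_ord -[RHS]cardsT -[RHS](card_imset _ inj); apply: eq_card => i.
  rewrite inE; apply/andP/imsetP => [[ai ib]|[i' _ ->]] /=.
    have lb : (i - a < b)%N by lia.
    by exists (Ordinal lb) => //; apply: val_inj => /=; rewrite subnKC.
  by rewrite leq_addr ltn_add2l.
have cX : #|X| = s.
  by rewrite -[RHS](cI 0%N s); [apply: eq_card => i; rewrite !inE|lia].
have cY : #|Y| = s := cI s s sn.
have XY : X :&: Y = set0 by apply/setP => i; rewrite !inE; lia.
pose B := pairs X :|: pairs Y.
pose cross : {set {set 'I_n}} := [set [set p.1; p.2] | p in setX X Y].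
have cC : #|cross| = (s * s)%N.
  rewrite card_in_imset; first by rewrite cardsX cX cY.
  move=> [x y] [x' y']; rewrite !inE /= => /andP[xX yY] /andP[xX' yY'] /setP h.
  have := h x; have := h y; rewrite !inE !eqxx orbT /= => /esym/orP[]/eqP e1 /esym/orP[]/eqP e2.
  - by move: yY xX'; rewrite e1; lia.
  - by move: yY xX'; rewrite e1; lia.
  - by rewrite e1 e2.
  - by move: xX yY'; rewrite e2; lia.
have cB : #|B| = (s * s.-1)%N.
  rewrite cardsU (_ : _ :&: _ = set0) ?cards0 ?subn0; last first.
    apply/setP => e; rewrite in_setI in_set0; apply/negP => /andP[/pairsP[x [y [xX _ _ ->]]]].
    rewrite inE => /andP[/subsetP/(_ x)]; rewrite !inE eqxx => /(_ isT) xY _.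
    by move: xX xY; rewrite inE; lia.
  rewrite !card_pairs cX cY addnn bin2 even_halfK //.
  by rewrite oddM; case: (s) => //= s'; rewrite andNb.
have Bcross : B :&: cross = set0.
  apply/setP => e; rewrite in_setI in_set0; apply/negP => /andP[+ /imsetP[[x y]]].
  rewrite !inE => eB /andP[/= xs sy] ee.
  case/orP: eB => /andP[/subsetP sub _].
    by have := sub y; rewrite ee !inE eqxx orbT => /(_ isT); lia.
  by have := sub x; rewrite ee !inE eqxx => /(_ isT); lia.
(* [J] is recovered from [B :|: J] by intersecting with [cross], which is disjoint from [B]. *)
rewrite -cC -cards_draws -(card_in_imset (f := fun J => B :|: J)); last first.
  move=> J J'; rewrite !inE => /andP[JC _] /andP[JC' _] /(congr1 (setI cross)).
  by rewrite (setIUr cross B J) (setIUr cross B J') (setIC cross B) Bcross !set0U (setIidPr JC) (setIidPr JC').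
apply: subset_leq_card; apply/subsetP => E /imsetP[J]; rewrite inE => /andP[JC /eqP Jj] ->{E}.
have mem_part e x : e \in B :|: J -> x \in e -> (x \in X) || (x \in Y).
  rewrite in_setU => /orP[|/(subsetP JC)/imsetP[[a d]]]; last first.
    by rewrite !inE /= => /andP[a1 d1] -> /set2P[]->; rewrite ?a1 ?d1 ?orbT.
  by rewrite in_setU => /orP[]; rewrite inE => /andP[/subsetP sub _] /sub ->; rewrite ?orbT.
have simple : simple_graph (B :|: J).
  apply/forallP => e; apply/implyP; rewrite in_setU => /orP[|/(subsetP JC)/imsetP[[a d]]].
    by rewrite !inE => /orP[] /andP[].
  by rewrite !inE /= => /andP[a1 d1] ->; rewrite cards2 (_ : a != d) //; apply: contraTneq d1 => <-; lia.
rewrite inE simple /=; apply/andP; split; last first.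
  rewrite cardsU cB Jj (_ : _ :&: _ = set0) ?cards0 ?subn0 //.
  by apply/eqP; rewrite -subset0 -Bcross setIS.
apply/(claw_freeP simple) => c x y z un.
have /and4P[_ /andP[xy xz] yz _] : [&& true, (x != y) && (x != z), y != z & true].
  by move: un; rewrite /= !inE !negb_or => /and4P[_ -> ->].
move=> cx cy cz nxy nxz nyz.
have same u v : u != v -> [set u; v] \notin B :|: J ->
    ~~ ((u \in X) && (v \in X)) /\ ~~ ((u \in Y) && (v \in Y)).
  move=> uv h; split; apply: contraNN h => /andP[h1 h2]; rewrite !in_setU.
    by rewrite (pairs2 h1 h2 uv).
  by rewrite (pairs2 h1 h2 uv) orbT.
have [a1 a2] := same _ _ xy nxy; have [a3 a4] := same _ _ xz nxz; have [a5 a6] := same _ _ yz nyz.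
have px := mem_part _ x cx (set22 _ _); have py := mem_part _ y cy (set22 _ _).
have pz := mem_part _ z cz (set22 _ _).
by move: a1 a2 a3 a4 a5 a6 px py pz; do 3 (case: (_ \in X); case: (_ \in Y)).
Qed.

End LowerBound.

(** * Claw-free graphs as a symmetric family *)

Section ClawFreeGraphs.
Import mathcomp.boot.fintype mathcomp.boot.finset.
Local Open Scope ring_scope.
Local Open Scope set_scope.
Variables (R : realType) (n m : nat).
Local Notation Om := (claw_free_graphs n m).

Lemma claw_free_graphs_edges (w : {set {set 'I_n}}) e : w \in Om -> e \in w -> #|e| = 2%N.
Proof. by rewrite inE => /and3P[/forallP/(_ e)/implyP h _ _] /h/eqP. Qed.

Lemma claw_free_graphs_card (w : {set {set 'I_n}}) : w \in Om -> #|w| = m.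
Proof. by rewrite inE => /and3P[_ _ /eqP]. Qed.

Lemma claw_free_graphs_claw (w : {set {set 'I_n}}) c x y z : w \in Om ->
  uniq [:: c; x; y; z] ->
  [set c; x] \in w -> [set c; y] \in w -> [set c; z] \in w ->
  [set x; y] \notin w -> [set x; z] \notin w -> [set y; z] \notin w -> False.
Proof. by rewrite inE => /and3P[/claw_freeP h /h{}h _]; exact: h. Qed.

Lemma claw_free_graphs_perm (sg : {perm 'I_n}) (w : {set {set 'I_n}}) : w \in Om ->
  [set sg @: (e : {set 'I_n}) | e in w] \in Om.
Proof.
move=> wO; have inj : injective (fun e : {set 'I_n} => sg @: e).
  by apply: imset_inj; exact: perm_inj.
have simple : simple_graph [set sg @: (e : {set 'I_n}) | e in w].
  apply/forallP => e; apply/implyP => /imsetP[d dw ->].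
  by rewrite card_imset ?(claw_free_graphs_edges wO dw) //; exact: perm_inj.
rewrite inE simple card_imset // claw_free_graphs_card // eqxx andbT /=.
apply/(claw_freeP simple) => c x y z.
rewrite -(permKV sg c) -(permKV sg x) -(permKV sg y) -(permKV sg z).
move: (_ c) (_ x) (_ y) (_ z) => c' x' y' z'.
have im2 u v : ([set sg u; sg v] \in [set sg @: (e : {set 'I_n}) | e in w]) = ([set u; v] \in w).
  by rewrite -[RHS](mem_imset _ _ inj) /= imsetU1 imset_set1.
rewrite !im2 (map_inj_uniq perm_inj [:: c'; x'; y'; z']); exact: claw_free_graphs_claw wO.
Qed.

Lemma claw_free_graphs_upper (K L s : nat) (la : R) :
  (0 < #|Om|)%N -> (2 <= K)%N -> (0 < L)%N -> (2 <= s)%N -> 0 < la ->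
  0 <= ln (1 + la) + ln la -> (L.+1 * K + 2 <= n)%N ->
  ln (#|Om|%:R : R) / 'C(n, 2)%:R <=
    (ln (1 + la) + ln la) / 2 - ln la * (m%:R / 'C(n, 2)%:R) +
    ((ln (1 + la) - ln la) * (K%:R / 'C(K, 2)%:R) +
     (4 / s%:R + `|ln la| * (s%:R ^+ 2)^-1) +
     (1 + ln (1 + la) * (K%:R ^+ 4 * (6 / ((s%:R ^+ 2)^-1) ^+ 6))) * (ln 2 / L%:R)) +
    (L * K)%:R * ln 2 * (n%:R / 'C(n, 2)%:R).
Proof.
have := @finite_upper R _ Om m (@claw_free_graphs_edges) claw_free_graphs_card
  claw_free_graphs_perm claw_free_graphs_claw K L s la.
by rewrite card_ord.
Qed.

End ClawFreeGraphs.

(** * The extremal density and the two branches of the rate function *)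

Section Constants.
Local Open Scope ring_scope.
Variable R : realType.
Implicit Types gamma : R.

Lemma binary_entropyE (x : R) : binary_entropy x = nat_entropy x / ln 2.
Proof. by rewrite /binary_entropy /nat_entropy /log2; ring. Qed.

(* [p] is the density between the two cliques of the extremal graphs, whose
   odds [p / (1 - p)] are the dual variable of the edge constraint. *)
Lemma rstar_density gamma : 0 < gamma < 1 -> exists p : R,
  [/\ 0 < p < 1, gamma <= (1 + p) / 2,
      0 <= ln p - 2 * ln (1 - p),
      rstar gamma * ln 2 = (ln p - 2 * ln (1 - p)) / 2 - (ln p - ln (1 - p)) * gamma &
      rstar gamma * ln 2 = gamma / (1 + p) * nat_entropy p].
Proof.
move=> /andP[g0 g1]; rewrite /rstar !binary_entropyE.
have l2 : ln 2 != 0 :> R by rewrite gt_eqF // ln_gt0 // ltr1n.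
have r2 : Num.sqrt 5 ^+ 2 = 5 :> R by rewrite sqr_sqrtr.
have r0 : 0 <= Num.sqrt 5 :> R by exact: sqrtr_ge0.
set r := Num.sqrt 5 in r2 r0 *.
have rb : 2 < r < 3 by apply/andP; split; nra.
case: ifP => hg.
  (* [f] is the inverse golden ratio, with [f ^+ 2 = 1 - f]. Thus [p = (1 - p) ^+ 2], so
     [ln p - 2 * ln (1 - p)] vanishes and the bound is linear in [gamma]. *)
  exists ((3 - r) / 2); set f := (r - 1) / 2.
  have f0 : 0 < f by rewrite /f; lra.
  have pf : (3 - r) / 2 = f ^+ 2 by rewrite /f; nra.
  have qf : 1 - (3 - r) / 2 = f by rewrite /f; field.
  have lp : ln ((3 - r) / 2) = 2 * ln f by rewrite pf lnXn // mulr_natl.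
  have hp : nat_entropy ((3 - r) / 2) = - ((5 - r) / 2) * ln f.
    by rewrite /nat_entropy qf lp; move: (ln f) => y; rewrite /f; field.
  have rr : (5 + r) * (5 - r) = 20 by nra.
  rewrite qf lp hp; split; [lra|lra|lra| |].
    rewrite (_ : _ * ln 2 = - ((5 + r) * (5 - r)) / 20 * ln f * gamma); last by field.
    by rewrite rr; field.
  rewrite (_ : _ * ln 2 = - ((5 + r) * (5 - r)) / 20 * ln f * gamma); last by field.
  by rewrite rr; field; lra.
move: hg => /negbT; rewrite -leNgt => hg.
(* Now [gamma = (1 + p) / 2], and [gamma] being above the threshold means [(1 - p) ^+ 2 <= p]. *)
exists (2 * gamma - 1).
have p0 : 0 < 2 * gamma - 1 by lra.
have q0 : 0 < 1 - (2 * gamma - 1) by lra.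
split; [lra|lra| | |].
- rewrite subr_ge0 mulr_natl -lnXn // ler_ln ?posrE ?exprn_gt0 //; nra.
- by rewrite /nat_entropy; field.
- by rewrite /nat_entropy; field; lra.
Qed.

End Constants.

Local Open Scope classical_set_scope.
Local Open Scope ring_scope.

(** * Limits *)

Section Limits.
Variable R : realType.

Lemma cvg_congr (f g : nat -> R) (a b : R) : b = a ->
  (\forall n \near \oo, g n = f n) -> f @ \oo --> a -> g @ \oo --> b.
Proof.
move=> -> fg h; apply: cvg_trans h; apply: near_eq_cvg.
by apply: filterS fg => n.
Qed.

Lemma bin2R (n : nat) : 'C(n, 2)%:R * 2 = n%:R * (n%:R - 1) :> R.
Proof.
elim: n => [|n IH]; first by rewrite bin0n mul0r mul0r.
by rewrite binS bin1 natrD mulrDl IH -natr1; ring.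
Qed.

Lemma cvg_n_bin2 : (fun n => n%:R / 'C(n, 2)%:R : R) @ \oo --> (0 : R).
Proof.
have E : (fun n => n.+2%:R / 'C(n.+2, 2)%:R) = (fun n => 2 * harmonic n) :> (nat -> R).
  apply/funext => n; rewrite /harmonic /=; have := bin2R n.+2.
  have C0 : 'C(n.+2, 2)%:R != 0 :> R by rewrite gt_eqF // ltr0n bin_gt0.
  have n0 : n.+1%:R != 0 :> R by [].
  rewrite -[n.+2%:R]natr1; move: n.+1%:R 'C(n.+2, 2)%:R n0 C0 => y C y0 C0 h.
  apply: (mulIf C0); rewrite divfK //; apply: (mulIf y0).
  transitivity (C * 2); first by rewrite h; ring.
  by field.
have lim : (fun n => n.+2%:R / 'C(n.+2, 2)%:R : R) @ \oo --> (0 : R).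
  rewrite E -[X in _ --> X](mulr0 (2 : R)); apply: cvgM; first exact: cvg_cst.
  exact: cvg_harmonic.
by rewrite -cvg_shiftS -cvg_shiftS.
Qed.

Lemma cvg_n2_bin2 : (fun n => n%:R ^+ 2 / 'C(n, 2)%:R : R) @ \oo --> (2 : R).
Proof.
apply: (@cvg_congr (fun n => 2 + n%:R / 'C(n, 2)%:R) _ (2 + 0)); first by rewrite addr0.
  near=> n.
  have n2 : (2 <= n)%N by near: n; exact: nbhs_infty_ge.
  have C0 : 0 < ('C(n, 2)%:R : R) by rewrite ltr0n bin_gt0.
  apply: (mulIf (x := 'C(n, 2)%:R)); first by rewrite gt_eqF.
  by rewrite mulrDl !divfK ?gt_eqF // mulrC bin2R; ring.
by apply: cvgD; [exact: cvg_cst|exact: cvg_n_bin2].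
Unshelve. all: by end_near. Qed.

Lemma cvg_inv_n : (fun n => n%:R^-1 : R) @ \oo --> (0 : R).
Proof. by rewrite -cvg_shiftS; exact: cvg_harmonic. Qed.

Lemma cvg_trunc_div (c : R) : 0 <= c ->
  (fun n => (Num.truncn (c * n%:R))%:R / n%:R : R) @ \oo --> c.
Proof.
move=> c0; apply: (@squeeze_cvgr _ _ _ _ (fun n => c - n%:R^-1) (fun=> c)).
- near=> n; have n0 : 0 < (n%:R : R) by rewrite ltr0n; near: n; exact: nbhs_infty_ge.
  have /andP[h1 h2] := truncn_itv (mulr_ge0 c0 (ltW n0)).
  rewrite ler_pdivlMr // ler_pdivrMr // h1 andbT mulrBl mulVf ?gt_eqF //.
  by rewrite lerBlDr natr1 ltW.
- rewrite -{2}(subr0 c); apply: cvgB; [exact: cvg_cst|exact: cvg_inv_n].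
- exact: cvg_cst.
Unshelve. all: by end_near. Qed.

Lemma continuous_nat_entropy (p : R) : 0 < p < 1 -> {for p, continuous (@nat_entropy R)}.
Proof.
move=> /andP[p0 p1]; have q0 : 0 < 1 - p by rewrite subr_gt0.
have cid : (fun x : R => x) @ p --> p by exact: cvg_id.
have c1 : (fun x : R => 1 - x) @ p --> 1 - p by apply: cvgB => //; exact: cvg_cst.
rewrite /continuous_at /nat_entropy; apply: cvgB; apply: cvgM => //.
- exact: cvgN.
- exact: continuous_ln.
- by apply: (cvg_comp _ _ c1); exact: continuous_ln.
Qed.

(** * The two asymptotic bounds on the number of graphs *)

Section Sequence.
Variables (gamma : R) (m : nat -> nat).
Hypothesis hgamma : 0 < gamma < 1.
Hypothesis hm : asymp_equiv (fun n => (m n)%:R : R) (fun n => gamma * ('C(n, 2))%:R).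

Lemma cvg_edge_density : (fun n => (m n)%:R / 'C(n, 2)%:R : R) @ \oo --> gamma.
Proof.
have /andP[g0 _] := hgamma.
apply: (@cvg_congr (fun n => gamma * ((m n)%:R / (gamma * 'C(n, 2)%:R))) _ (gamma * 1)).
- by rewrite mulr1.
- near=> n.
  have n2 : (2 <= n)%N by near: n; exact: nbhs_infty_ge.
  have C0 : 0 < ('C(n, 2)%:R : R) by rewrite ltr0n bin_gt0.
  by field; rewrite !gt_eqF.
- by apply: cvgM; [exact: cvg_cst|exact: hm].
Unshelve. all: by end_near. Qed.

(** Cliques of order about $cn$ with density $p$ between them have about $c^2(1+p)n^2$ edges;
    equating this with $\gamma n^2/2$ fixes [c]. The hypothesis [gamma <= (1 + p) / 2] gives
    [c <= 1 / 2], so both cliques fit. *)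
Lemma count_lower_bound (p : R) : 0 < p < 1 -> gamma <= (1 + p) / 2 ->
  exists2 f : nat -> R, f @ \oo --> gamma / (1 + p) * nat_entropy p &
   \forall n \near \oo, (0 < #|claw_free_graphs n (m n)|)%N /\
     f n <= ln (#|claw_free_graphs n (m n)|%:R : R) / 'C(n, 2)%:R.
Proof.
move=> hp gp; have /andP[p0 p1] := hp; have /andP[g0 g1] := hgamma.
pose c := Num.sqrt (gamma / (2 * (1 + p))).
have c2 : c ^+ 2 = gamma / (2 * (1 + p)).
  by rewrite sqr_sqrtr // divr_ge0 ?mulr_ge0 //; lra.
have c0 : 0 < c by rewrite sqrtr_gt0 divr_gt0 ?mulr_gt0 //; lra.
have c2le : c ^+ 2 <= 1 / 4.
  by rewrite c2 ler_pdivrMr ?mulr_gt0 //; lra.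
have cle : c <= 1 / 2 by nra.
pose s n := Num.truncn (c * n%:R).
pose u n : R := (s n)%:R / n%:R.
have cu : u @ \oo --> c by apply: cvg_trunc_div; exact: ltW.
have ev_u := cvgr_gt _ cu _ c0.
pose size n : R := (s n)%:R ^+ 2 / 'C(n, 2)%:R.
have csize : size @ \oo --> gamma / (1 + p).
  apply: (@cvg_congr (fun n => u n * u n * (n%:R ^+ 2 / 'C(n, 2)%:R)) _ (c * c * 2)).
  - by rewrite -expr2 c2; field; lra.
  - near=> n; rewrite /u /size.
    have n2 : (2 <= n)%N by near: n; exact: nbhs_infty_ge.
    have n0 : 0 < (n%:R : R) by rewrite ltr0n; lia.
    have C0 : 0 < ('C(n, 2)%:R : R) by rewrite ltr0n bin_gt0.
    by field; rewrite !gt_eqF.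
  - by apply: cvgM; [exact: cvgM|exact: cvg_n2_bin2].
have lim0 : 0 < gamma / (1 + p) by rewrite divr_gt0 //; lra.
have cinvs : (fun n => ((s n)%:R)^-1 : R) @ \oo --> (0 : R).
  apply: (@cvg_congr (fun n => (u n)^-1 * n%:R^-1) _ (c^-1 * 0)); first by rewrite mulr0.
    near=> n; rewrite /u.
    have n0 : 0 < (n%:R : R) by rewrite ltr0n; near: n; exact: nbhs_infty_ge.
    have u0 : 0 < u n by near: n; exact: ev_u.
    have s0 : (s n)%:R != 0 :> R by apply: contraTneq u0; rewrite /u => ->; rewrite mul0r ltxx.
    by field; rewrite s0 gt_eqF.
  apply: cvgM; last exact: cvg_inv_n.
  by apply: cvgV => //; rewrite gt_eqF.
(* The exact density $(m - s(s-1))/s^2$ needed between the cliques. *)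
pose d n : R := ((m n)%:R / 'C(n, 2)%:R) / size n - 1 + ((s n)%:R)^-1.
have cd : d @ \oo --> p.
  have -> : p = gamma / (gamma / (1 + p)) - 1 + 0 by field; lra.
  apply: cvgD cinvs; apply: cvgB; last exact: cvg_cst.
  apply: cvgM; first exact: cvg_edge_density.
  by apply: cvgV => //; rewrite gt_eqF.
have ev_size := cvgr_gt _ csize _ lim0.
have ev_d0 := cvgr_gt _ cd _ p0.
have ev_d1 := cvgr_lt _ cd _ p1.
(* The error of [ln_bin_ge] is [4 * ln s + 2]; the two subtracted terms absorb it, as [ln s <= n]
   and [2 <= n]. *)
exists (fun n => size n * nat_entropy (d n) - (4 * (n%:R / 'C(n, 2)%:R) + 1 * (n%:R / 'C(n, 2)%:R))).
  rewrite -[gamma / _ * _]subr0; apply: cvgB.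
    apply: cvgM csize _; apply: continuous_cvg cd; exact: continuous_nat_entropy.
  have -> : 0 = 4 * 0 + 1 * 0 :> R by rewrite !mulr0 addr0.
  by apply: cvgD; apply: cvgM; [exact: cvg_cst|exact: cvg_n_bin2|exact: cvg_cst|exact: cvg_n_bin2].
near=> n.
have n2 : (2 <= n)%N by near: n; exact: nbhs_infty_ge.
have n0 : 0 < (n%:R : R) by rewrite ltr0n; lia.
have n2R : 2 <= (n%:R : R) by rewrite ler_nat.
have C0 : 0 < ('C(n, 2)%:R : R) by rewrite ltr0n bin_gt0.
have d0 : 0 < d n by near: n; exact: ev_d0.
have d1 : d n < 1 by near: n; exact: ev_d1.
have size0 : 0 < size n by near: n; exact: ev_size.
have sR : 0 < ((s n)%:R : R).
  rewrite lt_def ler0n andbT; apply: contraTneq size0; rewrite /size => ->.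
  by rewrite expr0n /= mul0r ltxx.
have sN : (0 < s n)%N by rewrite ltr0n in sR.
have sn : (s n)%:R <= c * n%:R by have /andP[] := truncn_itv (mulr_ge0 (ltW c0) (ltW n0)).
have sn2 : (s n + s n <= n)%N by rewrite -(ler_nat R) natrD; nra.
have dE : d n * ((s n)%:R * (s n)%:R) = (m n)%:R - (s n)%:R * ((s n)%:R - 1).
  by rewrite /d /size; field; rewrite !gt_eqF.
have predE : ((s n).-1)%:R = (s n)%:R - 1 :> R by rewrite -subn1 natrB.
have ss0 : 0 < (s n)%:R * (s n)%:R :> R by rewrite mulr_gt0.
have m1 : (s n * (s n).-1 < m n)%N.
  by rewrite -(ltr_nat R) natrM predE -subr_gt0 -dE mulr_gt0.
pose j := (m n - s n * (s n).-1)%N.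
have jE : j%:R = d n * (s n * s n)%:R :> R.
  by rewrite /j natrB ?(ltnW m1) // !natrM dE predE.
have j0 : (0 < j)%N by rewrite subn_gt0.
have j1 : (j < s n * s n)%N by rewrite -(ltr_nat R) jE natrM gtr_pMl.
have mE : (s n * (s n).-1 + j)%N = m n by rewrite subnKC // ltnW.
have := card_claw_free_ge sn2 (ltnW j1); rewrite mE => cnt.
have bin0 : (0 < 'C(s n * s n, j))%N by rewrite bin_gt0 ltnW.
split; first exact: leq_trans cnt.
have lnle : ln ('C(s n * s n, j)%:R : R) <= ln (#|claw_free_graphs n (m n)|%:R : R).
  by rewrite ler_ln ?posrE ?ltr0n ?ler_nat //; exact: leq_trans cnt.
have := @ln_bin_ge R (s n * s n) j; rewrite j0 j1 => /(_ isT).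
rewrite (_ : j%:R / _ = d n); last by rewrite jE mulfK // natrM gt_eqF.
have -> : ln ((s n * s n)%:R : R) = 2 * ln (s n)%:R.
  by rewrite natrM lnM ?posrE //; ring.
have lns : ln ((s n)%:R : R) <= n%:R.
  apply: le_trans (ltW (ln_sublinear sR)) _; nra.
move=> lb; rewrite ler_pdivlMr // mulrBl.
rewrite (_ : size n * _ * _ = (s n * s n)%:R * nat_entropy (d n)); last first.
  by rewrite /size natrM; field; rewrite gt_eqF.
rewrite (_ : (_ + _) * _ = 5 * n%:R); last by field; rewrite gt_eqF.
lra.
Unshelve. all: by end_near. Qed.

(** With [la] the odds of [p], [g + b] is [ln p - 2 * ln (1 - p)]. The parameters are fixed in the
    order [s], [K], [L], since the error governed by [L] involves the first two; only then does [n]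
    grow. These three, the edge density and [n] each cost at most [e]. *)
Lemma count_upper_bound (p eps : R) : 0 < p < 1 -> 0 <= ln p - 2 * ln (1 - p) -> 0 < eps ->
  \forall n \near \oo, (0 < #|claw_free_graphs n (m n)|)%N ->
    ln (#|claw_free_graphs n (m n)|%:R : R) / 'C(n, 2)%:R <=
    (ln p - 2 * ln (1 - p)) / 2 - (ln p - ln (1 - p)) * gamma + eps.
Proof.
move=> /andP[p0 p1] hp eps0.
have q0 : 0 < 1 - p by lra.
pose la := p / (1 - p).
have la0 : 0 < la by rewrite divr_gt0.
have bE : ln la = ln p - ln (1 - p) by rewrite ln_div.
have gE : ln (1 + la) = - ln (1 - p).
  by rewrite -lnV ?posrE //; congr (ln _); rewrite /la; field; rewrite gt_eqF.
set b := ln la in bE *; set g := ln (1 + la) in gE *.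
have gb : 0 <= g + b by rewrite gE bE; lra.
have g0 : 0 <= g by apply: ln_ge0; rewrite lerDl ltW.
have bg : b <= g by rewrite ler_ln ?posrE ?addr_gt0 // lerDr.
have ln20 : 0 < ln 2 :> R by rewrite ln_gt0 // ltr1n.
pose e := eps / 6; have e0 : 0 < e by rewrite /e divr_gt0.
have [s [s2 hs]] : exists s : nat, (2 <= s)%N /\ 4 / s%:R + `|b| * (s%:R ^+ 2)^-1 <= e.
  pose s := (Num.truncn ((4 + `|b|) / e)).+2; exists s; split=> //.
  have sR : 2 <= (s%:R : R) by rewrite ler_nat.
  have h : (4 + `|b|) / e < s%:R.
    by apply: lt_le_trans (truncnS_gt _) _; rewrite ler_nat.
  have b0 := normr_ge0 b.
  rewrite ltr_pdivrMr // in h.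
  apply: (@le_trans _ _ ((4 + `|b|) / s%:R)); last by rewrite ler_pdivrMr; lra.
  rewrite [leRHS]mulrDl lerD2l ler_wpM2l // lef_pV2 ?posrE ?exprn_gt0 //; nra.
have [K [K2 hK]] : exists K : nat, (2 <= K)%N /\ (g - b) * (K%:R / 'C(K, 2)%:R) <= e.
  have : (fun n => (g - b) * (n%:R / 'C(n, 2)%:R)) @ \oo --> (0 : R).
    have -> : 0 = (g - b) * 0 by rewrite mulr0.
    by apply: cvgM; [exact: cvg_cst|exact: cvg_n_bin2].
  move=> lim; have [M _ hM] := cvgr_lt _ lim _ e0.
  by exists (maxn 2 M); split; [exact: leq_maxl|apply/ltW/hM; exact: leq_maxr].
pose c := 1 + g * (K%:R ^+ 4 * (6 / ((s%:R ^+ 2)^-1) ^+ 6)).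
have [L [L0 hL]] : exists L : nat, (0 < L)%N /\ c * (ln 2 / L%:R) <= e.
  pose L := (Num.truncn (c * ln 2 / e)).+1; exists L; split=> //.
  have LR : 0 < (L%:R : R) by rewrite ltr0n.
  by rewrite mulrA ler_pdivrMr // [leRHS]mulrC -ler_pdivrMr // ltW // truncnS_gt.
have cm : (fun n => b * ((m n)%:R / 'C(n, 2)%:R) : R) @ \oo --> b * gamma.
  by apply: cvgM; [exact: cvg_cst|exact: cvg_edge_density].
have cn : (fun n => (L * K)%:R * ln 2 * (n%:R / 'C(n, 2)%:R) : R) @ \oo --> (0 : R).
  have -> : 0 = (L * K)%:R * ln 2 * 0 :> R by rewrite mulr0.
  by apply: cvgM; [exact: cvg_cst|exact: cvg_n_bin2].
have ev_b : \forall n \near \oo, b * gamma - e < b * ((m n)%:R / 'C(n, 2)%:R).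
  by apply: (cvgr_gt _ cm); rewrite ltrBlDr ltrDl.
have ev_n := cvgr_lt _ cn _ e0.
near=> n; move=> ne.
have nK : (L.+1 * K + 2 <= n)%N by near: n; exact: nbhs_infty_ge.
have h1 : b * gamma - e < b * ((m n)%:R / 'C(n, 2)%:R).
  by near: n; exact: ev_b.
have h2 : (L * K)%:R * ln 2 * (n%:R / 'C(n, 2)%:R) < e.
  by near: n; exact: ev_n.
have := @claw_free_graphs_upper R n (m n) K L s la ne K2 L0 s2 la0 gb nK.
rewrite -/b -/g -/c => main; apply: le_trans main _.
have -> : ln p - 2 * ln (1 - p) = g + b by rewrite gE bE; ring.
rewrite -bE; have : eps = 6 * e by rewrite /e; field.
lra.
Unshelve. all: by end_near. Qed.

End Sequence.
End Limits.

Theorem theorem1p1 (R : realType) (gamma : R) (m : nat -> nat)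
  (hgamma : 0 < gamma < 1)
  (hm : asymp_equiv (fun n => (m n)%:R : R)
                    (fun n => gamma * ('C(n, 2))%:R)) :
  (fun n => log2 ((#|claw_free_graphs n (m n)|)%:R : R) / ('C(n, 2))%:R)
    @ \oo --> rstar gamma.
Proof.
have [p [hp gp hb Eup Elo]] := rstar_density hgamma.
have ln20 : 0 < ln 2 :> R by rewrite ln_gt0 // ltr1n.
have [f cf hf] := count_lower_bound hgamma hm hp gp.
rewrite -Elo in cf.
have -> : (fun n => log2 (#|claw_free_graphs n (m n)|%:R : R) / 'C(n, 2)%:R) =
    (fun n => (ln (#|claw_free_graphs n (m n)|%:R : R) / 'C(n, 2)%:R) / ln 2).
  by apply/funext => n; rewrite /log2 mulrAC.
have ln2n : ln 2 != 0 :> R by rewrite gt_eqF.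
rewrite -(mulfK ln2n (rstar gamma)).
apply: cvgM; last exact: cvg_cst.
apply/cvgrPdist_le => eps eps0.
have hu := count_upper_bound hgamma hm hp hb eps0; rewrite -Eup in hu.
have hl : \forall n \near \oo, rstar gamma * ln 2 - eps < f n.
  by apply: (cvgr_gt _ cf); rewrite ltrBlDr ltrDl.
near=> n.
(* Nonemptiness comes with the lower bound and is the premise of the upper one. *)
have [ne lo] : (0 < #|claw_free_graphs n (m n)|)%N /\
    f n <= ln (#|claw_free_graphs n (m n)|%:R : R) / 'C(n, 2)%:R by near: n.
have up : (0 < #|claw_free_graphs n (m n)|)%N ->
    ln (#|claw_free_graphs n (m n)|%:R : R) / 'C(n, 2)%:R <= rstar gamma * ln 2 + eps by near: n.
have fl : rstar gamma * ln 2 - eps < f n by near: n.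
by rewrite ler_distlC; apply/andP; split; [exact: ltW (lt_le_trans fl lo)|exact: up].
Unshelve. all: by end_near. Qed.
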